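(* Let $(\mathfrak{A},\mathfrak{A}_0)$ be a $*$-semisimple Banach quasi $*$-algebra and let $\delta:\mathcal{D}(\delta)\to\mathfrak{A}$, with $\mathcal{D}(\delta)\subseteq\mathfrak{A}_b$, be a closed weak $*$-derivation of $(\mathfrak{A},\mathfrak{A}_0)$. Suppose that the resolvent set $\rho(\delta)$ contains $\mathbb{R}\setminus\{0\}$, that $\|\delta(a)-\lambda a\|\ge|\lambda|\,\|a\|$ for all $a\in\mathcal{D}(\delta)$ and $\lambda\in\mathbb{R}$, and that $\mathfrak{A}_0$ is a core for every multiplication operator $\hat{L}_a$, $a\in\mathfrak{A}$, i.e. $\hat{L}_a=\overline{L_a}$. Then $\delta$ is the infinitesimal generator of a uniformly bounded, norm-continuous one-parameter group of weak $*$-automorphisms of $(\mathfrak{A},\mathfrak{A}_0)$.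
   Context: A quasi $*$-algebra $(\mathfrak{A},\mathfrak{A}_0)$ consists of a vector space $\mathfrak{A}$ and a $*$-algebra $\mathfrak{A}_0\subseteq\mathfrak{A}$ such that $\mathfrak{A}$ carries an involution extending that of $\mathfrak{A}_0$, $\mathfrak{A}$ is an $\mathfrak{A}_0$-bimodule whose module multiplications extend the multiplication of $\mathfrak{A}_0$ with $(xa)y=x(ay)$, $a(xy)=(ax)y$ for $a\in\mathfrak{A}$, $x,y\in\mathfrak{A}_0$, and $(ax)^*=x^*a^*$. It is a Banach quasi $*$-algebra if $\mathfrak{A}$ is a Banach space with norm $\|\cdot\|$ such that $\|a^*\|=\|a\|$, $\mathfrak{A}_0$ is dense in $\mathfrak{A}$, and for each $x\in\mathfrak{A}_0$ the map $a\mapsto ax$ is continuous on $\mathfrak{A}$. Let $\mathcal{S}_{\mathfrak{A}_0}(\mathfrak{A})$ be the set of sesquilinear forms $\varphi$ on $\mathfrak{A}\times\mathfrak{A}$ with $\varphi(a,a)\ge 0$, $\varphi(ax,y)=\varphi(x,a^*y)$ for $a\in\mathfrak{A}$, $x,y\in\mathfrak{A}_0$, and $|\varphi(a,b)|\le\|a\|\|b\|$ for all $a,b\in\mathfrak{A}$. The Banach quasi $*$-algebra is $*$-semisimple if $\varphi(a,a)=0$ for all $\varphi\in\mathcal{S}_{\mathfrak{A}_0}(\mathfrak{A})$ implies $a=0$. For $a,b\in\mathfrak{A}$ the weak product $a\,\square\, b$ is well defined if there is a (necessarily unique) $c\in\mathfrak{A}$ with $\varphi(bx,a^*y)=\varphi(cx,y)$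 for all $x,y\in\mathfrak{A}_0$, $\varphi\in\mathcal{S}_{\mathfrak{A}_0}(\mathfrak{A})$; then $a\,\square\, b:=c$. For $a\in\mathfrak{A}$, $L_a:\mathfrak{A}_0\to\mathfrak{A}$, $L_ax=ax$, and $R_a:\mathfrak{A}_0\to\mathfrak{A}$, $R_ax=xa$; $\overline{L_a}$ is the norm closure of $L_a$; $\hat{L}_a$ is the operator $b\mapsto a\,\square\, b$ on the domain of all $b\in\mathfrak{A}$ for which $a\,\square\, b$ is well defined. An element $a$ is bounded if $L_a$ and $R_a$ are norm continuous; $\mathfrak{A}_b$ is the set of bounded elements. A weak $*$-derivation is a linear map $\delta:\mathcal{D}(\delta)\to\mathfrak{A}$, where $\mathcal{D}(\delta)\subseteq\mathfrak{A}$ is a subspace stable under the involution and regarded as a partial $*$-algebra with the weak multiplication, such that $\mathfrak{A}_0\subseteq\mathcal{D}(\delta)$, $\delta(x^* )=\delta(x)^*$ for $x\in\mathfrak{A}_0$, and whenever $a,b\in\mathcal{D}(\delta)$ and $a\,\square\, b$ is well defined, then $a\,\square\, b\in\mathcal{D}(\delta)$ and $\varphi(\delta(a\,\square\, b)x,y)=\varphi(bx,\delta(a)^*y)+\varphi(\delta(b)x,a^*y)$ for all $\varphi\in\mathcal{S}_{\mathfrak{A}_0}(\mathfrak{A})$, $x,y\in\mathfrak{A}_0$. Closed means closed as an operator in the Banach space $\mathfrak{A}$. For an operator $S$ on $\mathfrak{A}$, $\rho(S)=\{\lambda\in\mathbb{C}: (\lambda I-S)^{-1}\text{ exists and is bounded}\}$.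 A weak $*$-automorphism is a linear bijection $\theta:\mathfrak{A}\to\mathfrak{A}$ with $\theta(a^* )=\theta(a)^*$, such that $\theta(a)\,\square\,\theta(b)$ is well defined iff $a\,\square\, b$ is, and then $\theta(a\,\square\, b)=\theta(a)\,\square\,\theta(b)$. A one-parameter group of weak $*$-automorphisms is a family $\{\beta_t\}_{t\in\mathbb{R}}$ of weak $*$-automorphisms with $\beta_0=\mathrm{id}$, $\beta_{t+s}=\beta_t\circ\beta_s$; norm-continuous means $t\mapsto\beta_t(a)$ is norm continuous for each $a$; uniformly bounded means $\sup_t\|\beta_t\|<\infty$. Its infinitesimal generator has domain the set of $a$ for which $\lim_{t\to0}(\beta_t(a)-a)/t$ exists in norm, with value that limit. *)

(* Defs.v *)
From HB Require Import structures.
From mathcomp Require Import all_boot all_order all_algebra.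
From mathcomp Require Import complex.
From mathcomp Require Import all_classical all_reals all_analysis.
Set Implicit Arguments. Unset Strict Implicit. Unset Printing Implicit Defensive.
Import Order.TTheory GRing.Theory Num.Theory.
Import numFieldNormedType.Exports.
Local Open Scope classical_set_scope.
Local Open Scope ring_scope.

Section QuasiStar.
Variables (R : realType) (V : completeNormedModType R[i]).

(* A Banach quasi *-algebra structure (A, A0) on the complex Banach space V.
   [A0] is the *-subalgebra, [inv] the involution, [mul] the (partial) product;
   [mul a b] is only meaningful when a or b lies in A0. *)
Record BQSA := {
  A0 : set V;
  inv : V -> V;
  mul : V -> V -> V;
  inv_add : forall a b, inv (a + b) = inv a + inv b;
  inv_scale : forall (k : R[i]) a, inv (k *: a) = k^* *: inv a;
  inv_invol : forall a, inv (inv a) = a;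
  A0_0 : A0 0;
  A0_add : forall x y, A0 x -> A0 y -> A0 (x + y);
  A0_scale : forall (k : R[i]) x, A0 x -> A0 (k *: x);
  A0_inv : forall x, A0 x -> A0 (inv x);
  A0_mul : forall x y, A0 x -> A0 y -> A0 (mul x y);
  A0_assoc : forall x y z, A0 x -> A0 y -> A0 z ->
    mul (mul x y) z = mul x (mul y z);
  A0_inv_mul : forall x y, A0 x -> A0 y -> inv (mul x y) = mul (inv y) (inv x);
  mulDl_l : forall x a b, A0 x -> mul x (a + b) = mul x a + mul x b;
  mulDr_l : forall x y a, A0 x -> A0 y -> mul (x + y) a = mul x a + mul y a;
  mulZ_l : forall (k : R[i]) x a, A0 x ->
    mul x (k *: a) = k *: mul x a /\ mul (k *: x) a = k *: mul x a;
  mulDl_r : forall a b x, A0 x -> mul (a + b) x = mul a x + mul b x;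
  mulDr_r : forall a x y, A0 x -> A0 y -> mul a (x + y) = mul a x + mul a y;
  mulZ_r : forall (k : R[i]) a x, A0 x ->
    mul (k *: a) x = k *: mul a x /\ mul a (k *: x) = k *: mul a x;
  mod_assoc_l : forall x y a, A0 x -> A0 y -> mul (mul x y) a = mul x (mul y a);
  mod_assoc_r : forall a x y, A0 x -> A0 y -> mul a (mul x y) = mul (mul a x) y;
  mod_assoc_m : forall x a y, A0 x -> A0 y -> mul (mul x a) y = mul x (mul a y);
  inv_mul_mod : forall a x, A0 x -> inv (mul a x) = mul (inv x) (inv a);
  norm_inv : forall a, `|inv a| = `|a|;
  A0_dense : closure A0 = setT;
  mul_r_cont : forall x, A0 x -> continuous (fun a => mul a x)
}.

Variable Q : BQSA.

Definition sesquilinear (phi : V -> V -> R[i]) :=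
  (forall a b c, phi (a + b) c = phi a c + phi b c) /\
  (forall (k : R[i]) a c, phi (k *: a) c = k * phi a c) /\
  (forall a b c, phi a (b + c) = phi a b + phi a c) /\
  (forall (k : R[i]) a c, phi a (k *: c) = k^* * phi a c).

Definition SA0 : set (V -> V -> R[i]) := [set phi |
  sesquilinear phi /\
  (forall a, 0 <= phi a a) /\
  (forall a x y, A0 Q x -> A0 Q y -> phi (mul Q a x) y = phi x (mul Q (inv Q a) y)) /\
  (forall a b, `|phi a b| <= `|a| * `|b|)].

Definition star_semisimple :=
  forall a, (forall phi, SA0 phi -> phi a a = 0) -> a = 0.

Definition is_weak_prod (a b c : V) :=
  forall phi, SA0 phi -> forall x y, A0 Q x -> A0 Q y ->
    phi (mul Q b x) (mul Q (inv Q a) y) = phi (mul Q c x) y.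

Definition weak_prod_defined (a b : V) := exists c, is_weak_prod a b c.

Definition bounded_elt (a : V) :=
  (exists M : R[i], forall x, A0 Q x -> `|mul Q a x| <= M * `|x|) /\
  (exists M : R[i], forall x, A0 Q x -> `|mul Q x a| <= M * `|x|).

Definition graph_L (a : V) : set (V * V) := [set p | A0 Q p.1 /\ p.2 = mul Q a p.1].
Definition graph_Lhat (a : V) : set (V * V) := [set p | is_weak_prod a p.1 p.2].

Definition A0_core_for_all :=
  forall a, closure (graph_L a) = graph_Lhat a.

Definition weak_star_derivation (D : set V) (delta : V -> V) :=
  [/\ D 0 /\ (forall a b, D a -> D b -> D (a + b)) /\
        (forall (k : R[i]) a, D a -> D (k *: a)),
      (forall a, D a -> D (inv Q a)),
      (forall a b, D a -> D b -> delta (a + b) = delta a + delta b) /\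
        (forall (k : R[i]) a, D a -> delta (k *: a) = k *: delta a),
      (forall x, A0 Q x -> D x) /\
        (forall x, A0 Q x -> delta (inv Q x) = inv Q (delta x)) &
      (forall a b c, D a -> D b -> is_weak_prod a b c ->
         D c /\
         forall phi, SA0 phi -> forall x y, A0 Q x -> A0 Q y ->
           phi (mul Q (delta c) x) y =
           phi (mul Q b x) (mul Q (inv Q (delta a)) y) +
           phi (mul Q (delta b) x) (mul Q (inv Q a) y))].

Definition closed_op (D : set V) (delta : V -> V) :=
  closed [set p : V * V | D p.1 /\ p.2 = delta p.1].

Definition in_resolvent (D : set V) (delta : V -> V) (lambda : R[i]) :=
  (forall a b, D a -> D b -> lambda *: a - delta a = lambda *: b - delta b -> a = b) /\
  (forall c, exists2 a, D a & lambda *: a - delta a = c) /\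
  (exists M : R[i], forall a, D a -> `|a| <= M * `|lambda *: a - delta a|).

Definition weak_star_automorphism (theta : V -> V) :=
  [/\ (forall a b, theta (a + b) = theta a + theta b) /\
        (forall (k : R[i]) a, theta (k *: a) = k *: theta a),
      bijective theta,
      (forall a, theta (inv Q a) = inv Q (theta a)),
      (forall a b, weak_prod_defined a b <-> weak_prod_defined (theta a) (theta b)) &
      (forall a b c, is_weak_prod a b c ->
         is_weak_prod (theta a) (theta b) (theta c))].

Definition one_param_group (beta : R -> V -> V) :=
  (forall t, weak_star_automorphism (beta t)) /\
  (forall a, beta 0 a = a) /\
  (forall t s a, beta (t + s) a = beta t (beta s a)).

Definition norm_continuous_group (beta : R -> V -> V) :=
  forall a, continuous (fun t => beta t a).

Definition uniformly_bounded_group (beta : R -> V -> V) :=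
  exists M : R[i], forall t a, `|beta t a| <= M * `|a|.

Definition is_generator (beta : R -> V -> V) (D : set V) (delta : V -> V) :=
  forall a,
    (D a <-> exists l : V, (fun t : R => ((t^-1)%:C)%C *: (beta t a - a)) @ 0^' --> l) /\
    (D a -> (fun t : R => ((t^-1)%:C)%C *: (beta t a - a)) @ 0^' --> delta a).

End QuasiStar.

(* Main.v *)
(** The resolvents [J_h = (1 - h delta)^-1], [h] real, are contractions with
    [|J_(p+q) a - J_p (J_q a)| <= |p q| |delta^2 a|], so the Euler products
    [J_(t/2^k)^(2^k)] converge to a group of isometries [S t] generated by [delta].

    Compatibility with the involution: [delta' a = delta(a^#)^#] generates another
    isometric group on the same domain, so [delta - delta'] is dissipative; it vanishes
    on the dense set A0, and a densely defined dissipative operator is closable, hence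
    it is zero.

    Compatibility with the product: uniform boundedness applied to [c |-> (J_1 c) x] bounds
    left multiplication by [a] in D by the graph norm of [a], which is constant along the
    orbit. Hence [t |-> S t a [] S t b] is differentiable for [a, b] in D and solves the same
    evolution equation as [S t (a [] b)]. The graph of the weak product is closed, and the
    core hypothesis carries the identity from A0 to arbitrary weak products. *)
Require Import Defs.
From HB Require Import structures.
From mathcomp Require Import all_boot all_order all_algebra.
From mathcomp Require Import complex ring lra.
From mathcomp Require Import all_classical all_reals all_analysis.
Import Order.TTheory GRing.Theory Num.Theory.
Import numFieldNormedType.Exports.
Local Open Scope classical_set_scope.
Local Open Scope ring_scope.

Set Implicit Arguments. Unset Strict Implicit. Unset Printing Implicit Defensive.

Local Notation "t *:r a" := ((t%:C)%C *: a) (at level 40, left associativity).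

(** * Real-valued norm and epsilon forms of limits and closures *)

Section RealNorm.
Variables (R : realType) (V : normedModType R[i]).
Implicit Types (a b c : V) (s t e : R).

(** The norm of [V] takes its values in [R[i]]; its real part carries the same information and lives
    in an ordered field with a total order. *)
Definition rnorm a : R := complex.Re `|a|.

Lemma rnormE a : `|a| = ((rnorm a)%:C)%C.
Proof. by rewrite /rnorm RRe_real// normr_real. Qed.

Lemma rnorm_ge0 a : 0 <= rnorm a.
Proof. by rewrite -lecR -rnormE normr_ge0. Qed.

Lemma rnorm0 : rnorm (0 : V) = 0.
Proof. by rewrite /rnorm normr0. Qed.

Lemma rnorm_eq0 a : rnorm a = 0 -> a = 0.
Proof. by move=> a0; apply/normr0_eq0; rewrite rnormE a0. Qed.

Lemma rnormD a b : rnorm (a + b) <= rnorm a + rnorm b.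
Proof. by rewrite -lecR rmorphD /= -!rnormE ler_normD. Qed.

Lemma rnormN a : rnorm (- a) = rnorm a.
Proof. by rewrite /rnorm normrN. Qed.

Lemma rnormB a b : rnorm (a - b) <= rnorm a + rnorm b.
Proof. by rewrite -(rnormN b) rnormD. Qed.

Lemma rnormC a b : rnorm (a - b) = rnorm (b - a).
Proof. by rewrite -rnormN opprB. Qed.

Lemma rnorm_trans b a c : rnorm (a - c) <= rnorm (a - b) + rnorm (b - c).
Proof. by rewrite -{1}(subrK b a) -addrA rnormD. Qed.

Lemma rnorm_leD a b : rnorm a <= rnorm (a - b) + rnorm b.
Proof. by rewrite -{1}(subrK b a) rnormD. Qed.

Lemma rnorm_dist a b : `|rnorm a - rnorm b| <= rnorm (a - b).
Proof.
rewrite ler_norml lerBrDl !lerBlDr rnorm_leD andbT [leRHS]addrC rnormC.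
exact: rnorm_leD.
Qed.

Lemma normcR t : `|(t%:C)%C| = ((`|t|)%:C)%C :> R[i].
Proof. by rewrite normc_def /= expr0n addr0 sqrtr_sqr. Qed.

Lemma rnormZ t a : rnorm (t *:r a) = `|t| * rnorm a.
Proof.
by apply: complexI; rewrite rmorphM/= -!rnormE normrZ normcR.
Qed.

Lemma rnorm_small a : (forall e, 0 < e -> rnorm a <= e) -> a = 0.
Proof.
move=> ae; apply/rnorm_eq0/eqP; rewrite eq_le rnorm_ge0 andbT.
by apply/ler_addgt0Pr => e /ae; rewrite add0r.
Qed.

Lemma rnorm_nbhs a (A : set V) :
  nbhs a A <-> exists2 e, 0 < e & forall b, rnorm (a - b) < e -> A b.
Proof.
split=> [/nbhs_normP[e /= e0 eA]|[e e0 eA]].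
  have eR : e = ((complex.Re e)%:C)%C by rewrite RRe_real// gtr0_real.
  exists (complex.Re e); first by rewrite -ltcR -eR.
  by move=> b ab; apply: eA; rewrite /ball_ /= rnormE eR ltcR.
apply/nbhs_normP; exists (e%:C)%C; first by rewrite /= ltcR.
by move=> b; rewrite /ball_ /= rnormE ltcR => /eA.
Qed.

Lemma rnorm_cvg (T : Type) (F : set_system T) (f : T -> V) l : Filter F ->
  f @ F --> l <-> forall e, 0 < e -> \forall x \near F, rnorm (f x - l) <= e.
Proof.
move=> FF; split=> [fl e e0|fl A /rnorm_nbhs[e e0 eA]].
  apply: (fl [set b | rnorm (b - l) <= e]); apply/rnorm_nbhs; exists e => //= b.
  by rewrite rnormC => /ltW.
have e20 : 0 < e / 2 by rewrite divr_gt0.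
rewrite /nbhs /=; near=> x; apply: eA; rewrite rnormC.
apply: (@le_lt_trans _ _ (e / 2)); last by rewrite ltr_pdivrMr// ltr_pMr// ltr1n.
by near: x; exact: fl.
Unshelve. all: by end_near. Qed.

Lemma rnorm_closureP (A : set V) a :
  closure A a <-> forall e, 0 < e -> exists2 x, A x & rnorm (a - x) <= e.
Proof.
split=> [Aa e e0|Aa B /rnorm_nbhs[e e0 eB]].
  have /Aa[x [Ax /= ax]] : nbhs a [set b | rnorm (a - b) <= e].
    by apply/rnorm_nbhs; exists e => // b /ltW.
  by exists x.
have [x Ax ax] := Aa (e / 2) ltac:(by rewrite divr_gt0).
exists x; split=> //; apply: eB; apply: le_lt_trans ax _.
by rewrite ltr_pdivrMr// ltr_pMr// ltr1n.
Qed.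

Lemma rnorm_closure2P (A : set (V * V)) a b : closure A (a, b) <->
  forall e, 0 < e -> exists p, [/\ A p, rnorm (a - p.1) <= e & rnorm (b - p.2) <= e].
Proof.
split=> [Aab e e0|Aab B].
  have /Aab[p [Ap [/= pa pb]]] :
      nbhs (a, b) [set p | rnorm (a - p.1) <= e /\ rnorm (b - p.2) <= e].
    exists ([set x | rnorm (a - x) <= e], [set x | rnorm (b - x) <= e]).
      by split; apply/rnorm_nbhs; exists e => // c /ltW.
    by move=> [x y] /= [].
  by exists p.
move=> [[P S] [/= /rnorm_nbhs[e e0 eP] /rnorm_nbhs[f f0 fS]] PSB].
have ef0 : 0 < Num.min e f by rewrite lt_min e0.
have [p [Ap pa pb]] := Aab (Num.min e f / 2) ltac:(by rewrite divr_gt0).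
have lt2 : Num.min e f / 2 < Num.min e f by rewrite ltr_pdivrMr// ltr_pMr// ltr1n.
exists p; split=> //; apply: PSB; split => /=.
  by apply: eP; apply: le_lt_trans pa (lt_le_trans lt2 _); rewrite ge_min lexx.
by apply: fS; apply: le_lt_trans pb (lt_le_trans lt2 _); rewrite ge_min lexx orbT.
Qed.

Definition rcvg (u : nat -> V) l :=
  forall e, 0 < e -> exists K, forall k, (K <= k)%N -> rnorm (u k - l) <= e.

Lemma rcvg_unique (u : nat -> V) l l' : rcvg u l -> rcvg u l' -> l = l'.
Proof.
move=> ul ul'; apply/subr0_eq/rnorm_small => e e0.
have e20 : 0 < e / 2 by rewrite divr_gt0.
have [[K uK] [K' uK']] := (ul _ e20, ul' _ e20).
apply: le_trans (rnorm_trans (u (maxn K K')) _ _) _.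
rewrite [e]splitr lerD//; first by rewrite rnormC uK// leq_max leqnn.
by rewrite uK'// leq_max leqnn orbT.
Qed.

Lemma rcvg_le (u : nat -> V) l (m : R) : rcvg u l ->
  (forall k, rnorm (u k) <= m) -> rnorm l <= m.
Proof.
move=> ul um; apply/ler_addgt0Pr => e e0; have [K uK] := ul e e0.
rewrite -[l](subrK (u K)); apply: le_trans (rnormD _ _) _.
by rewrite addrC lerD// rnormC uK.
Qed.

Lemma rcvg_cst l : rcvg (fun=> l) l.
Proof. by move=> e /ltW e0; exists 0%N => k _; rewrite subrr rnorm0. Qed.

Lemma rcvgD (u v : nat -> V) l m : rcvg u l -> rcvg v m ->
  rcvg (fun k => u k + v k) (l + m).
Proof.
move=> ul vm e e0; have e20 : 0 < e / 2 by rewrite divr_gt0.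
have [[K uK] [K' vK]] := (ul _ e20, vm _ e20).
exists (maxn K K') => k; rewrite geq_max => /andP[kK kK'].
rewrite opprD addrACA [e]splitr; apply: le_trans (rnormD _ _) _.
by rewrite lerD ?uK ?vK.
Qed.

Lemma rcvg_map (f : V -> V) (C : R) (u : nat -> V) l :
  (forall a b, rnorm (f a - f b) <= C * rnorm (a - b)) ->
  rcvg u l -> rcvg (f \o u) (f l).
Proof.
(* The sign of [C] is unknown, so the tolerance is divided by the positive number [|C| + 1]. *)
move=> fC ul e e0; have C0 : 0 < `|C| + 1 by rewrite ltr_wpDl.
have [K uK] := ul (e / (`|C| + 1)) ltac:(by rewrite divr_gt0).
exists K => k /uK kK; apply: le_trans (fC _ _) _.
have := ler_wpM2l (ltW C0) kK; rewrite mulrCA divff ?gt_eqF// mulr1.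
apply: le_trans; rewrite ler_wpM2r ?rnorm_ge0//.
by rewrite (le_trans (ler_norm _))// lerDl.
Qed.

Lemma rcvgZ (k : R[i]) (u : nat -> V) l : rcvg u l -> rcvg (fun n => k *: u n) (k *: l).
Proof.
apply: (@rcvg_map ( *:%R k) (complex.Re `|k|)) => a b.
by rewrite -scalerBr -lecR rmorphM /= -!rnormE normrZ.
Qed.

Lemma rcvg_harmonic (u : nat -> V) l :
  (forall k, rnorm (l - u k) <= k.+1%:R^-1) -> rcvg u l.
Proof.
move=> uP e e0; have [K Ke] : exists K, e^-1 < K.+1%:R :> R.
  by exists (Num.truncn e^-1); rewrite truncnS_gt.
exists K => k kK; rewrite rnormC; apply: le_trans (uP k) _.
rewrite invf_ple ?posrE ?ltr0Sn//; apply: ltW; apply: lt_le_trans Ke _.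
by rewrite ler_nat ltnS.
Qed.

Lemma dense_rcvg (A : set V) a :
  (forall b e, 0 < e -> exists2 x, A x & rnorm (b - x) <= e) ->
  exists2 u : nat -> V, forall k, A (u k) & rcvg u a.
Proof.
move=> dA; have /choice[u uP] k : exists x, A x /\ rnorm (a - x) <= k.+1%:R^-1.
  by have [x] := dA a k.+1%:R^-1 ltac:(by rewrite invr_gt0); exists x.
by exists u => [k|]; [have [] := uP k | apply: rcvg_harmonic => k; have [] := uP k].
Qed.
End RealNorm.

(** * Cauchy sequences *)

Section Completeness.
Variables (R : realType) (V : completeNormedModType R[i]).

Lemma rcauchy_rcvg (u : nat -> V) :
  (forall e : R, 0 < e -> exists K, forall k, (K <= k)%N -> rnorm (u k - u K) <= e) ->
  exists l, rcvg u l.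
Proof.
move=> uC; exists (lim (u @ \oo)).
have /cauchy_cvgP uc : cauchy (u @ \oo).
  apply: cauchy_exP => e e0.
  have eR : e = ((complex.Re e)%:C)%C by rewrite RRe_real// gtr0_real.
  have re0 : 0 < complex.Re e by rewrite -ltcR -eR.
  have [K uK] := uC (complex.Re e / 2) ltac:(by rewrite divr_gt0).
  exists (u K); exists K => // k /= /uK ukK.
  rewrite -ball_normE /ball_ /= rnormE eR ltcR rnormC; apply: le_lt_trans ukK _.
  by rewrite ltr_pdivrMr// ltr_pMr// ltr1n.
move=> e e0; have /rnorm_cvg/(_ e e0)[K _ uK] : u @ \oo --> lim (u @ \oo) by [].
by exists K => k /uK.
Qed.
End Completeness.

(** * Linear contractions and their iterates *)

Section Contractions.
Variables (R : realType) (V : normedModType R[i]).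
Implicit Types (T A B : V -> V) (a b : V).

Record contraction T : Prop := Contraction {
  ctrD : forall a b, T (a + b) = T a + T b;
  ctrZ : forall (k : R[i]) a, T (k *: a) = k *: T a;
  ctr_le : forall a, rnorm (T a) <= rnorm a
}.

Lemma ctrN T a : contraction T -> T (- a) = - T a.
Proof. by move=> cT; rewrite -scaleN1r ctrZ// scaleN1r. Qed.

Lemma ctrB T a b : contraction T -> T (a - b) = T a - T b.
Proof. by move=> cT; rewrite ctrD// ctrN. Qed.

Lemma ctr_leB T a b : contraction T -> rnorm (T a - T b) <= 1 * rnorm (a - b).
Proof. by move=> cT; rewrite mul1r -ctrB// ctr_le. Qed.

Lemma ctr_comp A B : contraction A -> contraction B -> contraction (A \o B).
Proof.
move=> cA cB; split=> [a b|k a|a] /=; first by rewrite !ctrD.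
  by rewrite !ctrZ.
exact: le_trans (ctr_le cA _) (ctr_le cB _).
Qed.

Lemma ctr_iter n T : contraction T -> contraction (iter n T).
Proof.
by move=> cT; elim: n => [|n ih]; [split | exact: (ctr_comp cT ih)].
Qed.

Lemma iter_comm n A B a : (forall c, A (B c) = B (A c)) ->
  iter n A (B a) = B (iter n A a).
Proof. by move=> AB; elim: n => //= n ->. Qed.

Lemma iter_comp n A B a : (forall c, A (B c) = B (A c)) ->
  iter n (A \o B) a = iter n A (iter n B a).
Proof.
by move=> AB; elim: n a => //= n ih a; rewrite ih (iter_comm n (iter n B a) AB).
Qed.

(** Telescoping: as [A] and [B] commute, A^n - B^n is a sum of [n] terms, each a contraction applied
    to [A - B]. *)
Lemma ctr_iter_dist n A B a : contraction A -> contraction B ->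
  (forall c, A (B c) = B (A c)) ->
  rnorm (iter n A a - iter n B a) <= n%:R * rnorm (A a - B a).
Proof.
move=> cA cB AB; elim: n => [|n ih]; first by rewrite /= subrr rnorm0 mul0r.
apply: le_trans (rnorm_trans (iter n A (B a)) _ _) _.
rewrite iterSr -(ctrB _ _ (ctr_iter n cA)) -natr1 mulrDl mul1r addrC.
apply: lerD; last exact: ctr_le (ctr_iter n cA) _.
apply: le_trans ih; rewrite iter_comm// iterS -ctrB//; exact: ctr_le.
Qed.

Lemma ctr_eq_dense (P : set V) A B : contraction A -> contraction B ->
  (forall b (e : R), 0 < e -> exists2 x, P x & rnorm (b - x) <= e) ->
  (forall x, P x -> A x = B x) -> forall a, A a = B a.
Proof.
move=> cA cB dP AB a; have [u Pu ua] := dense_rcvg a dP.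
apply: (rcvg_unique (rcvg_map (fun a b => ctr_leB a b cA) ua)).
have -> : A \o u = B \o u by apply/funext => k /=; exact: AB.
exact: (rcvg_map (fun a b => ctr_leB a b cB) ua).
Qed.
End Contractions.

(** * Generation of an isometric group by Euler products of resolvents *)

Section HilleYosida.
Variables (R : realType) (V : completeNormedModType R[i]).
Variables (D : set V) (delta : V -> V).

(** Differentiability at 0 is written with [|h| * e] on the right, which avoids dividing by [h] and
    includes [h = 0]. The field [gg_max] makes [D] the whole domain of the generator. *)
Record group_generated (S : R -> V -> V) : Prop := GroupGenerated {
  gg_ctr : forall t, contraction (S t);
  gg_0 : forall a, S 0 a = a;
  gg_add : forall t s a, S (t + s) a = S t (S s a);
  gg_dom : forall t a, D a -> D (S t a);
  gg_gen : forall t a, D a -> delta (S t a) = S t (delta a);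
  gg_lip : forall t a, D a -> rnorm (S t a - a) <= `|t| * rnorm (delta a);
  gg_deriv : forall a, D a -> forall e : R, 0 < e -> exists2 r : R, 0 < r &
    forall h, `|h| < r -> rnorm (S h a - a - h *:r delta a) <= `|h| * e;
  gg_max : forall a l, (forall e : R, 0 < e -> exists2 r : R, 0 < r &
    forall h, `|h| < r -> rnorm (S h a - a - h *:r l) <= `|h| * e) -> D a
}.

Hypothesis (DD : forall a b, D a -> D b -> D (a + b)).
Hypothesis (DZ : forall (k : R[i]) a, D a -> D (k *: a)).
Hypothesis (dD : forall a b, D a -> D b -> delta (a + b) = delta a + delta b).
Hypothesis (dZ : forall (k : R[i]) a, D a -> delta (k *: a) = k *: delta a).
Hypothesis (Ddense : forall a (e : R), 0 < e -> exists2 x, D x & rnorm (a - x) <= e).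
Hypothesis (range_D : forall h : R, h != 0 -> forall c,
  exists2 a, D a & a - h *:r delta a = c).
Hypothesis (dissipative : forall (h : R) a, D a -> rnorm a <= rnorm (a - h *:r delta a)).

Lemma dom_sub a b : D a -> D b -> D (a - b).
Proof. by move=> Da Db; rewrite -scaleN1r; apply/DD/DZ. Qed.

Lemma gen_sub a b : D a -> D b -> delta (a - b) = delta a - delta b.
Proof.
move=> Da Db; rewrite -(scaleN1r b) dD ?(dZ _ Db) ?(scaleN1r (delta b))//.
exact: DZ.
Qed.

(** This is (1 - h delta)^-1, with the identity as its value at [h = 0] so that the identities below
    hold for every real [h]. The default 0 of [xget] is never taken, by [range_D]. *)
Definition resolvent (h : R) (c : V) : V :=
  if h == 0 then c else xget 0 [set a | D a /\ a - h *:r delta a = c].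
Local Notation J := resolvent.

Lemma resolvent0 c : J 0 c = c.
Proof. by rewrite /J eqxx. Qed.

Lemma resolvent_dom h c : h != 0 -> D (J h c).
Proof.
move=> h0; rewrite /J (negbTE h0); have [a Da ac] := range_D h0 c.
by case: xgetP => [y _ []|/(_ a)/(_ (conj Da ac))].
Qed.

Lemma resolventE h c : h != 0 -> J h c - h *:r delta (J h c) = c.
Proof.
move=> h0; rewrite /J (negbTE h0); have [a Da ac] := range_D h0 c.
by case: xgetP => [y _ []|/(_ a)/(_ (conj Da ac))].
Qed.

Lemma resolventK h a : D a -> J h (a - h *:r delta a) = a.
Proof.
move=> Da; have [->|h0] := eqVneq h 0; first by rewrite resolvent0 scale0r subr0.
set c := a - _; have Db := resolvent_dom c h0; apply/subr0_eq/rnorm_eq0/eqP.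
rewrite eq_le rnorm_ge0 andbT; apply: le_trans (dissipative h (dom_sub Db Da)) _.
by rewrite gen_sub// scalerBr [- (_ - _)]opprD addrACA resolventE// -opprD -/c subrr rnorm0.
Qed.

Lemma resolvent_ctr h : contraction (J h).
Proof.
have [->|h0] := eqVneq h 0; first by split=> *; rewrite !resolvent0.
split=> [a b|k a|a].
- rewrite -[in LHS](resolventE a h0) -[in LHS](resolventE b h0) addrACA -opprD -scalerDr -dD.
  + by rewrite resolventK//; apply: DD; exact: resolvent_dom.
  + exact: resolvent_dom.
  + exact: resolvent_dom.
- rewrite -[in LHS](resolventE a h0) scalerBr scalerA mulrC -scalerA -dZ.
    by rewrite resolventK//; exact/DZ/resolvent_dom.
  exact: resolvent_dom.
- by rewrite -[in leRHS](resolventE a h0); apply/dissipative/resolvent_dom.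
Qed.

Lemma resolvent_comm_delta h a : D a -> D (J h a) /\ delta (J h a) = J h (delta a).
Proof.
move=> Da; have [->|h0] := eqVneq h 0; first by rewrite !resolvent0.
have Db := resolvent_dom a h0; split => //; set b := J h a in Db *.
(* [h *:r delta b = b - a] is a difference of two elements of [D]. *)
have Ddb : D (delta b).
  have hb : h *:r delta b = b - a by rewrite -(resolventE a h0) -/b subKr.
  rewrite -[delta b]scale1r -(rmorph1 (real_complex R)) -(mulVf h0) rmorphM/=.
  by rewrite -scalerA hb; apply/DZ/dom_sub.
by rewrite -(resolventE a h0) -/b gen_sub ?dZ ?resolventK//; exact: DZ.
Qed.

Lemma resolvent_dom_delta h a : h != 0 -> D a -> D (delta (J h a)).
Proof. by move=> h0 Da; rewrite (resolvent_comm_delta h Da).2; exact: resolvent_dom. Qed.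

Lemma resolvent_sub h a : D a -> J h a - a = h *:r J h (delta a).
Proof.
move=> Da; have [->|h0] := eqVneq h 0; first by rewrite resolvent0 subrr scale0r.
by rewrite -{2}(resolventE a h0) subKr (resolvent_comm_delta h Da).2.
Qed.

(** Write [c] as (1 - k delta) b with b = [J k c]. Since [J h] commutes with [delta] on [D], [J h c]
    is (1 - k delta) applied to [J h b], and [J k] undoes this. *)
Lemma resolvent_comm h k c : J h (J k c) = J k (J h c).
Proof.
have [->|h0] := eqVneq h 0; first by rewrite !resolvent0.
have [->|k0] := eqVneq k 0; first by rewrite !resolvent0.
have Dk := resolvent_dom c k0; have cJ := resolvent_ctr h.
rewrite -[in RHS](resolventE c k0) (ctrB _ _ cJ) (ctrZ cJ) -(resolvent_comm_delta h Dk).2.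
by rewrite resolventK//; exact: resolvent_dom.
Qed.

(* (1 - pd)(1 - qd) = (1 - (p + q)d) + pq d^2, hence the second order error term. *)
Lemma resolvent_add p q a : D a -> D (delta a) ->
  rnorm (J (p + q) a - J p (J q a)) <= `|p * q| * rnorm (delta (delta a)).
Proof.
move=> Da Dda; have [[cJ cp] cq] := (resolvent_ctr (p + q), resolvent_ctr p, resolvent_ctr q).
have Dq : D (a - q *:r delta a) by apply/dom_sub/DZ.
(* The argument of the two resolvents is the expanded product (1 - p delta)(1 - q delta) a. Applying
   [J (p + q)] to this identity cancels its first-order part and leaves the [p * q] term. *)
have aE : a = J q (J p (a - (p + q) *:r delta a + (p * q) *:r delta (delta a))).
  rewrite -[LHS](resolventK q Da) -[in LHS](resolventK p Dq); congr (J q (J p _)).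
  rewrite gen_sub ?dZ//; last exact: DZ.
  rewrite rmorphD rmorphM /= scalerDl scalerBr scalerA opprB opprD !addrA.
  by rewrite [LHS]addrAC; congr (_ + _); exact: addrAC.
suff -> : J (p + q) a - J p (J q a) =
    (p * q) *:r J (p + q) (J p (J q (delta (delta a)))).
  rewrite rnormZ ler_wpM2l//; apply: le_trans (ctr_le cJ _) _.
  by apply: le_trans (ctr_le cp _) _; exact: ctr_le.
rewrite [X in J (p + q) X]aE (ctrD cp) (ctrD cq) (ctrD cJ) (ctrZ cp) (ctrZ cq) (ctrZ cJ).
rewrite -(resolvent_comm p q (a - _)) -(resolvent_comm p q (delta _)).
rewrite (resolvent_comm (p + q)) (resolvent_comm (p + q) q) resolventK//.
by rewrite addrAC subrr add0r.
Qed.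

(** On [D] the difference [J h d - d = h *:r J h (delta d)] is O(h); density of [D] and
    contractivity give all of [V]. *)
Lemma resolvent_approx c (e : R) : 0 < e -> exists2 h, h != 0 & rnorm (c - J h c) <= e.
Proof.
move=> e0; have e30 : 0 < e / 3 by rewrite divr_gt0.
have [d Dd cd] := Ddense c e30.
have n0 : 0 < 1 + rnorm (delta d) by rewrite ltr_pwDl// rnorm_ge0.
pose h := e / 3 / (1 + rnorm (delta d)).
have h0 : 0 < h by rewrite divr_gt0.
exists h; first by rewrite gt_eqF.
have -> : e = e / 3 + (e / 3 + e / 3) by field.
apply: le_trans (rnorm_trans d _ _) _; rewrite lerD//.
apply: le_trans (rnorm_trans (J h d) _ _) _; apply: lerD; last first.
  rewrite -ctrB; last exact: resolvent_ctr.
  by apply: le_trans (ctr_le (resolvent_ctr h) _) _; rewrite rnormC.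
rewrite rnormC resolvent_sub// rnormZ gtr0_norm//.
apply: (@le_trans _ _ (h * (1 + rnorm (delta d)))); last by rewrite mulfVK ?gt_eqF.
rewrite ler_pM2l//; apply: le_trans (ctr_le (resolvent_ctr h) _) _.
by rewrite lerDr.
Qed.

(** The error terms contain delta^2, so estimates start on its domain; [J h] maps [D] into it. *)
Lemma dom2_dense a (e : R) : 0 < e ->
  exists2 x, D x /\ D (delta x) & rnorm (a - x) <= e.
Proof.
move=> e0; have e20 : 0 < e / 2 by rewrite divr_gt0.
have [d Dd ad] := Ddense a e20; have [h h0 dh] := resolvent_approx d e20.
exists (J h d); first by split; [exact: resolvent_dom|exact: resolvent_dom_delta].
by apply: le_trans (rnorm_trans d _ _) _; rewrite [e]splitr lerD.
Qed.

(** The Euler product (1 - (t/n) delta)^-n along n = 2^k: passing from [k] to [k.+1] replaces each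
    factor by two factors of half the step. *)
Definition euler (k : nat) (t : R) : V -> V := iter (2 ^ k) (J (t / 2 ^+ k)).

Lemma euler_ctr k t : contraction (euler k t).
Proof. exact/ctr_iter/resolvent_ctr. Qed.

(** Replacing J_(2p) by J_p^2 costs p^2 |delta^2 a| with p = t / 2^(k+1), and this happens 2^k
    times. *)
Lemma euler_step k t a : D a -> D (delta a) ->
  rnorm (euler k.+1 t a - euler k t a) <= (t ^+ 2 * rnorm (delta (delta a))) / 2 ^+ k.
Proof.
move=> Da Dda; rewrite /euler expnSr iterM.
apply: le_trans (ctr_iter_dist _ _ (ctr_iter 2 (resolvent_ctr _)) (resolvent_ctr _) _) _.
  by move=> c; rewrite (iter_comm 2)// => c'; exact: resolvent_comm.
set p := t / 2 ^+ k.+1; have ->: t / 2 ^+ k = p + p.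
  by rewrite /p exprS; field; rewrite expf_neq0//= pnatr_eq0.
rewrite rnormC /=.
have n0 : 0 < (2 : R) ^+ k by rewrite exprn_gt0.
apply: le_trans (ler_wpM2l (ler0n _ _) (resolvent_add p p Da Dda)) _.
rewrite natrX -expr2 ger0_norm ?sqr_ge0// mulrA [leRHS]mulrAC ler_wpM2r ?rnorm_ge0//.
have -> : 2 ^+ k * p ^+ 2 = t ^+ 2 / 2 ^+ k / 4.
  by rewrite /p [2 ^+ k.+1]exprS; move: (2 ^+ k) n0 => x x0; field; rewrite gt_eqF.
by rewrite ler_pdivrMr// ler_peMr ?ler1n// divr_ge0 ?sqr_ge0// ltW.
Qed.

Lemma euler_cvg2 t a : D a -> D (delta a) -> exists l, rcvg (fun k => euler k t a) l.
Proof.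
move=> Da Dda; set C := t ^+ 2 * rnorm (delta (delta a)).
have C0 : 0 <= C by rewrite mulr_ge0 ?sqr_ge0 ?rnorm_ge0.
apply: rcauchy_rcvg => e e0.
have [K Ke] : exists K, 2 * C / e <= 2 ^+ K.
  exists (Num.truncn (2 * C / e)).+1; apply: le_trans (ltW (truncnS_gt _)) _.
  by rewrite -natrX ler_nat ltnW// ltn_expl.
exists K => k /subnKC <-; have p0 j : 0 < (2 : R) ^+ j by rewrite exprn_gt0.
(* The sum of C / 2^i for i from K to k - 1, in closed form. *)
apply: (@le_trans _ _ (2 * C / 2 ^+ K - 2 * C / 2 ^+ (K + (k - K)))).
  elim: (k - K)%N => [|j ih]; first by rewrite addn0 !subrr rnorm0.
  apply: le_trans (rnorm_trans (euler (K + j) t a) _ _) _.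
  rewrite addnS; apply: le_trans (lerD (euler_step _ _ Da Dda) ih) _.
  rewrite -/C [2 ^+ _.+1]exprS le_eqVlt; apply/orP; left; apply/eqP.
  by move: (2 ^+ K) (p0 K) (2 ^+ (K + j)) (p0 (K + j)%N) => x x0 y y0; field;
    rewrite !gt_eqF.
rewrite lerBlDr; apply: (@le_trans _ _ e).
  by rewrite ler_pdivrMr// [e * _]mulrC -ler_pdivrMr.
by rewrite lerDl; apply: divr_ge0; [rewrite mulr_ge0 | exact: ltW].
Qed.

Lemma euler_cvg t a : exists l, rcvg (fun k => euler k t a) l.
Proof.
apply: rcauchy_rcvg => e e0; have e40 : 0 < e / 4 by rewrite divr_gt0.
have [x [Dx Ddx] ax] := dom2_dense a e40.
have [l xl] := euler_cvg2 t Dx Ddx; have [K xK] := xl _ e40.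
exists K => k kK; apply: le_trans (rnorm_trans (euler k t x) _ _) _.
have -> : e = e / 4 + (e / 4 + (e / 4 + e / 4)) by field.
apply: lerD; first by rewrite -ctrB; [exact: le_trans (ctr_le (euler_ctr _ _) _) ax
                                     | exact: euler_ctr].
apply: le_trans (rnorm_trans l _ _) _; apply: lerD; first exact: xK.
apply: le_trans (rnorm_trans (euler K t x) _ _) _.
apply: lerD; first by rewrite rnormC xK.
rewrite -ctrB; last exact: euler_ctr.
by apply: le_trans (ctr_le (euler_ctr _ _) _) _; rewrite rnormC.
Qed.

Definition euler_limit (t : R) (a : V) : V := xget 0 [set l | rcvg (fun k => euler k t a) l].
Local Notation S := euler_limit.

Lemma euler_limit_cvg t a : rcvg (fun k => euler k t a) (S t a).
Proof.
rewrite /S; have [l tl] := euler_cvg t a.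
by case: xgetP => [y _//|/(_ l)/(_ tl)].
Qed.

Lemma euler_limitE t a l : rcvg (fun k => euler k t a) l -> S t a = l.
Proof. exact: rcvg_unique (euler_limit_cvg t a). Qed.

Lemma euler_limit_ctr t : contraction (S t).
Proof.
split=> [a b|k a|a].
- apply: euler_limitE; have := rcvgD (euler_limit_cvg t a) (euler_limit_cvg t b).
  by congr rcvg; apply/funext => n; rewrite (ctrD (euler_ctr _ _)).
- apply: euler_limitE; have := rcvgZ k (euler_limit_cvg t a).
  by congr rcvg; apply/funext => n; rewrite (ctrZ (euler_ctr _ _)).
- by apply: rcvg_le (euler_limit_cvg t a) _ => k; exact: ctr_le (euler_ctr _ _) _.
Qed.

Lemma euler_limit0 a : S 0 a = a.
Proof.
apply: euler_limitE; have := rcvg_cst a; congr rcvg; apply/funext => k.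
rewrite /euler mul0r; elim: (2 ^ k)%N => //= n <-; exact/esym/resolvent0.
Qed.

Lemma euler_limit_comp t s a : rcvg (fun k => euler k t (euler k s a)) (S t (S s a)).
Proof.
move=> e e0; have e20 : 0 < e / 2 by rewrite divr_gt0.
have [K sK] := euler_limit_cvg s a e20; have [K' tK] := euler_limit_cvg t (S s a) e20.
exists (maxn K K') => k; rewrite geq_max => /andP[kK kK'].
apply: le_trans (rnorm_trans (euler k t (S s a)) _ _) _.
rewrite [e]splitr lerD ?tK// -ctrB; last exact: euler_ctr.
exact: le_trans (ctr_le (euler_ctr _ _) _) (sK _ kK).
Qed.

(** On the domain of delta^2, the factors J_((t+s)/2^k) and J_(t/2^k) J_(s/2^k) differ by O(4^-k),
    so their 2^k-th iterates differ by O(2^-k). Density does the rest. *)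
Lemma euler_limit_add t s a : S (t + s) a = S t (S s a).
Proof.
have cts := ctr_comp (euler_limit_ctr t) (euler_limit_ctr s).
apply: (ctr_eq_dense (euler_limit_ctr _) cts dom2_dense) => {}a [Da Dda].
apply: euler_limitE; rewrite -[_ a]add0r.
pose u k := (euler k (t + s) a - euler k t (euler k s a)).
have := rcvgD (_ : rcvg u 0) (euler_limit_comp t s a).
have -> : (fun k => u k + euler k t (euler k s a)) = fun k => euler k (t + s) a.
  by apply/funext => k; rewrite /u subrK.
apply=> e e0; set C := `|t * s| * rnorm (delta (delta a)).
have [K Ke] : exists K, C / e <= 2 ^+ K.
  exists (Num.truncn (C / e)).+1; apply: le_trans (ltW (truncnS_gt _)) _.
  by rewrite -natrX ler_nat ltnW// ltn_expl.
exists K => k kK; rewrite subr0 /u /euler -iter_comp; last by move=> c; exact: resolvent_comm.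
have cJ p q := ctr_comp (resolvent_ctr p) (resolvent_ctr q).
apply: le_trans (ctr_iter_dist _ _ (resolvent_ctr _) (cJ _ _) _) _.
  by move=> c /=; rewrite (resolvent_comm _ (t / _)) (resolvent_comm _ (s / _)).
have n0 j : 0 < (2 : R) ^+ j by rewrite exprn_gt0.
rewrite mulrDl /= natrX; apply: le_trans (ler_wpM2l (ltW (n0 _)) (resolvent_add _ _ Da Dda)) _.
rewrite mulrACA -invfM normrM normfV (gtr0_norm (mulr_gt0 (n0 k) (n0 k))).
have -> : 2 ^+ k * (`|t * s| / (2 ^+ k * 2 ^+ k) * rnorm (delta (delta a))) = C / 2 ^+ k.
  by rewrite /C; field; rewrite gt_eqF.
rewrite ler_pdivrMr// [e * _]mulrC -ler_pdivrMr//; apply: le_trans Ke _.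
by rewrite ler_weXn2l// ler1n.
Qed.

Lemma euler_limit_resolvent t h a : S t (J h a) = J h (S t a).
Proof.
apply: euler_limitE.
have := rcvg_map (fun a b => ctr_leB a b (resolvent_ctr h)) (euler_limit_cvg t a).
congr rcvg; apply/funext => k /=; rewrite /euler [RHS]iter_comm// => c.
exact: resolvent_comm.
Qed.

(** [S t] commutes with [J 1], so [S t a] is [J 1] of [S t (a - delta a)]; membership in [D] and the
    value of [delta] are read off the resolvent equation. *)
Lemma euler_limit_dom_gen t a : D a -> D (S t a) /\ delta (S t a) = S t (delta a).
Proof.
move=> Da; have one0 : (1 : R) != 0 := oner_neq0 _.
have SaE : S t a = J 1 (S t (a - 1 *:r delta a)) by rewrite -euler_limit_resolvent resolventK.
have DSa : D (S t a) by rewrite SaE; exact: resolvent_dom.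
split=> //; have := resolventE (S t (a - 1 *:r delta a)) one0.
rewrite -SaE (ctrB _ _ (euler_limit_ctr t)) (ctrZ (euler_limit_ctr t)).
by move/addrI/oppr_inj; rewrite !scale1r.
Qed.

(** The Euler product is compared with iterates of the identity: 2^k steps, each moving [a] by at
    most |t| / 2^k times |delta a|. *)
Lemma euler_limit_lip t a : D a -> rnorm (S t a - a) <= `|t| * rnorm (delta a).
Proof.
move=> Da; have c1 : contraction (@id V) by split.
apply: (rcvg_le (rcvgD (euler_limit_cvg t a) (rcvg_cst (- a)))) => k.
have -> : euler k t a - a = euler k t a - iter (2 ^ k) id a.
  by congr (_ - _); elim: (2 ^ k)%N.
apply: le_trans (ctr_iter_dist _ _ (resolvent_ctr _) c1 _) _; first by [].
have n0 j : 0 < (2 : R) ^+ j by rewrite exprn_gt0.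
rewrite resolvent_sub// rnormZ normrM normfV natrX (gtr0_norm (n0 k)) mulrA mulrCA.
rewrite divff ?gt_eqF// mulr1 ler_wpM2l//; exact: ctr_le (resolvent_ctr _) _.
Qed.

Lemma resolvent_iter_taylor n h a : D a -> D (delta a) ->
  rnorm (iter n (J h) a - a - (h * n%:R) *:r delta a)
    <= (h * n%:R) ^+ 2 * rnorm (delta (delta a)).
Proof.
move=> Da Dda; elim: n => [|n ih].
  by rewrite /= mulr0 subrr scale0r subr0 rnorm0 expr0n mul0r.
have cJ := resolvent_ctr h; set E := _ - _ - _ in ih; set d2 := rnorm (delta _) in ih *.
(* Recursion for the Taylor remainder [E]. The new term is at most h^2 (n + 1) |delta^2 a|, and n^2
   + (n + 1) <= (n + 1)^2 closes the induction. *)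
have -> : iter n.+1 (J h) a - a - (h * n.+1%:R) *:r delta a =
    J h E + (h * (n%:R + 1)) *:r (J h (delta a) - delta a).
  rewrite /E iterS !(ctrB _ _ cJ) (ctrZ cJ) -natr1 [in RHS]scalerBr addrA; congr (_ - _).
  rewrite mulrDr mulr1 rmorphD scalerDl /= addrA subrK -resolvent_sub//.
  by rewrite addrA subrK.
apply: le_trans (rnormD _ _) _; rewrite rnormZ resolvent_sub// rnormZ.
apply: le_trans (lerD (ctr_le cJ _) _) _.
- apply: (ler_wpM2l (normr_ge0 _)); apply: (ler_wpM2l (normr_ge0 _)).
  exact: (ctr_le cJ).
apply: le_trans (lerD ih (lexx _)) _; rewrite -/d2 mulrA -mulrDl.
apply: ler_wpM2r; first exact: rnorm_ge0.
rewrite normrM (@ger0_norm _ (n%:R + 1)) ?addr_ge0//.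
rewrite mulrAC -expr2 -normrX ger0_norm ?sqr_ge0// !exprMn -mulrDr.
by rewrite ler_wpM2l ?sqr_ge0// -natr1; have : 0 <= n%:R :> R by []; nra.
Qed.

Lemma euler_limit_taylor t a : D a -> D (delta a) ->
  rnorm (S t a - a - t *:r delta a) <= t ^+ 2 * rnorm (delta (delta a)).
Proof.
move=> Da Dda; rewrite -addrA.
apply: (rcvg_le (rcvgD (euler_limit_cvg t a) (rcvg_cst (- a - t *:r delta a)))) => k.
have := resolvent_iter_taylor (2 ^ k) (t / 2 ^+ k) Da Dda.
by rewrite natrX mulfVK ?gt_eqF ?exprn_gt0// addrA.
Qed.

(** The Taylor bound requires delta^2, so [a] is replaced by [x = J k a], for which
    [delta x = J k (delta a)] is close to [delta a]; the Lipschitz bound controls the contribution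
    of [a - x]. *)
Lemma euler_limit_deriv a : D a -> forall e : R, 0 < e -> exists2 r : R, 0 < r &
  forall h, `|h| < r -> rnorm (S h a - a - h *:r delta a) <= `|h| * e.
Proof.
move=> Da e e0; have e30 : 0 < e / 3 by rewrite divr_gt0.
have [k k0] := resolvent_approx (delta a) e30; rewrite -(resolvent_comm_delta k Da).2.
have [Dx Ddx] : D (J k a) /\ D (delta (J k a)).
  by split; [exact: resolvent_dom|exact: resolvent_dom_delta].
move: (J k a) Dx Ddx => x Dx Ddx ax; set d2 := rnorm (delta (delta x)).
have n0 : 0 < 1 + d2 by rewrite ltr_pwDl// rnorm_ge0.
exists (e / 3 / (1 + d2)); first by rewrite divr_gt0.
move=> h hr; have -> : S h a - a - h *:r delta a = (S h (a - x) - (a - x)) +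
    ((S h x - x - h *:r delta x) - h *:r (delta a - delta x)).
  rewrite (ctrB _ _ (euler_limit_ctr h)) scalerBr.
  have -> : S h a - S h x - (a - x) = S h a - a - (S h x - x).
    by rewrite !opprD addrACA.
  by rewrite (opprB (h *:r delta a)) [S h x - x - _ + _]addrA subrK addrA subrK.
have -> : `|h| * e = `|h| * (e / 3) + (`|h| * (e / 3) + `|h| * (e / 3)) by field.
apply: le_trans (rnormD _ _) _; apply: lerD.
  apply: le_trans (euler_limit_lip _ (dom_sub Da Dx)) _; rewrite ler_wpM2l//.
  by rewrite gen_sub.
apply: le_trans (rnormB _ _) _; apply: lerD; last by rewrite rnormZ ler_wpM2l.
apply: le_trans (euler_limit_taylor _ Dx Ddx) _.
rewrite -normr_id -real_normK ?num_real// normr_id expr2 -mulrA ler_wpM2l// -/d2.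
apply: (@le_trans _ _ (`|h| * (1 + d2))); first by rewrite ler_wpM2l// lerDr.
by rewrite -ler_pdivlMr// ltW.
Qed.

(** Smoothing by [J 1]: the orbit of [J 1 a] has at 0 both derivatives [delta (J 1 a)] and [J 1 l].
    They agree, so the resolvent equation gives [a = J 1 a - J 1 l], an element of [D]. *)
Lemma euler_limit_max a l : (forall e : R, 0 < e -> exists2 r : R, 0 < r &
  forall h, `|h| < r -> rnorm (S h a - a - h *:r l) <= `|h| * e) -> D a.
Proof.
move=> al; have one0 : (1 : R) != 0 := oner_neq0 _.
have Dx := resolvent_dom a one0; have cJ := resolvent_ctr 1.
suff dE : delta (J 1 a) = J 1 l.
  have := resolventE a one0; rewrite dE => <-; apply: dom_sub => //.
  exact/DZ/resolvent_dom.
apply/subr0_eq/rnorm_small => e e0; have e20 : 0 < e / 2 by rewrite divr_gt0.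
have [r r0 ar] := al _ e20; have [r' r'0 xr] := euler_limit_deriv Dx e20.
pose h := Num.min r r' / 2; have m0 : 0 < Num.min r r' by rewrite lt_min r0.
have h0 : 0 < h by rewrite divr_gt0.
have : h < Num.min r r' by rewrite ltr_pdivrMr// ltr_pMr// ltr1n.
rewrite lt_min -(gtr0_norm h0) => /andP[/ar {}ar /xr {}xr].
have : rnorm (h *:r (delta (J 1 a) - J 1 l)) <= `|h| * e.
  rewrite [e]splitr mulrDr.
  have := rnorm_trans (S h (J 1 a) - J 1 a) (h *:r delta (J 1 a)) (h *:r J 1 l).
  rewrite -scalerBr => /le_trans; apply; apply: lerD; first by rewrite rnormC.
  rewrite euler_limit_resolvent -!(ctrB _ _ cJ) -(ctrZ cJ) -(ctrB _ _ cJ).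
  exact: le_trans (ctr_le cJ _) _.
by rewrite rnormZ ler_pM2l// normr_gt0 gt_eqF.
Qed.

Lemma hille_yosida : exists S, group_generated S.
Proof.
exists S; split.
- exact: euler_limit_ctr.
- exact: euler_limit0.
- exact: euler_limit_add.
- by move=> t a Da; have [] := euler_limit_dom_gen t Da.
- by move=> t a Da; have [] := euler_limit_dom_gen t Da.
- exact: euler_limit_lip.
- exact: euler_limit_deriv.
- exact: euler_limit_max.
Qed.
End HilleYosida.

Lemma zero_derivative_cst (R : realType) (f : R -> R) :
  (forall t e : R, 0 < e -> exists2 r : R, 0 < r &
    forall h, `|h| < r -> `|f (t + h) - f t| <= `|h| * e) ->
  forall x y, f x = f y.
Proof.
move=> f0 x y; apply: is_derive_0_is_cst => {x y} t.
have df : (fun h => h^-1 *: (f (h *: 1 + t) - f t)) @ 0^' --> (0 : R).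
  apply/cvgrPdist_le => e e0; have [r r0 fr] := f0 t e e0.
  apply/nbhs_ballP; exists r => //= h; rewrite /ball /= sub0r normrN => hr h0.
  rewrite sub0r normrN normrZ normfV -ler_pdivlMl ?invr_gt0 ?normr_gt0// invrK.
  by rewrite [h *: 1]mulr1 (addrC h) fr.
apply: DeriveDef; first by apply/cvg_ex; exists 0.
exact: cvg_lim df.
Qed.

(** * The uniform boundedness principle *)

Section UniformBoundedness.
Variables (R : realType) (V : completeNormedModType R[i]).

(** Nested balls: without a common constant, every ball contains a smaller one on which some member
    of [F] has norm at least [n]; a point common to all these balls contradicts the pointwise
    bound. *)
Lemma uniform_boundedness (F : set (V -> V)) :
  (forall T, F T -> [/\ forall a b, T (a + b) = T a + T b,
     forall (k : R) a, T (k *:r a) = k *:r T a &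
     exists C : R, forall a, rnorm (T a) <= C * rnorm a]) ->
  (forall a, exists M : R, forall T, F T -> rnorm (T a) <= M) ->
  exists C : R, forall T, F T -> forall a, rnorm (T a) <= C * rnorm a.
Proof.
move=> FL Fpt; apply: contrapT => nF.
have nC (C : R) : exists T a, F T /\ C * rnorm a < rnorm (T a).
  apply: contrapT => H; apply: nF; exists C => T FT a.
  by rewrite leNgt; apply/negP => Ta; apply: H; exists T, a.
(* A pair is a ball: centre and radius. The two halves [p.2 / 2] put the new ball inside the old
   one. *)
have step (n : nat) (p : V * R) : exists q : V * R, 0 < p.2 ->
    [/\ 0 < q.2, q.2 <= p.2 / 2, rnorm (q.1 - p.1) <= p.2 / 2 &
     exists2 T, F T & forall y, rnorm (y - q.1) <= q.2 -> n%:R <= rnorm (T y)].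
  case: p => x r /=; have [r0|r0] := ltP 0 r; last by exists (x, r).
  (* With this constant, rescaling [z] to the norm r/2 gives [w] with |T w| at least n + 1. *)
  have [T [z [FT Tz]]] := nC ((n%:R + 1) * (2 / r)).
  have [TD TZ [C TC]] := FL T FT.
  have TB a b : T (a - b) = T a - T b.
    by have := TD (a - b) b; rewrite subrK => ->; rewrite addrK.
  have m0 : 0 < rnorm z.
    rewrite lt_neqAle rnorm_ge0 andbT eq_sym; apply/eqP => m0; move: Tz.
    by have := TC z; rewrite m0 !mulr0 => /le_lt_trans h /h; rewrite ltxx.
  pose w := (r / 2 / rnorm z) *:r z.
  have wr : rnorm w = r / 2.
    by rewrite rnormZ gtr0_norm ?divr_gt0// mulfVK// gt_eqF.
  have Tw : n%:R + 1 <= rnorm (T w).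
    rewrite TZ rnormZ gtr0_norm ?divr_gt0// mulrAC ler_pdivlMr//.
    by rewrite -ler_pdivrMl ?divr_gt0// invf_div mulrCA mulrA ltW.
  (* As T(x + w) - T(x - w) = 2 T w, one of the two points has an image of norm at least that of
     [T w]. *)
  have [x' xr Tx'] : exists2 x', rnorm (x' - x) <= r / 2 & n%:R + 1 <= rnorm (T x').
    have [h|h] := leP (rnorm (T w)) (rnorm (T (x + w))).
      by exists (x + w); [rewrite addrC addKr wr|exact: le_trans h].
    exists (x - w); first by rewrite addrC addKr rnormN wr.
    apply: le_trans Tw _; rewrite -(lerD2l (rnorm (T w))).
    apply: le_trans (_ : rnorm (T w + T w) <= _).
      have -> : T w + T w = 2 *:r T w.
        by rewrite -{1 2}[T w]scale1r -scalerDl -(rmorph1 (real_complex R)) -rmorphD.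
      by rewrite rnormZ ger0_norm// mulr_natl.
    have -> : T w + T w = T (x + w) - T (x - w).
      by rewrite TD TB opprB [RHS]addrC addrA subrK.
    by apply: le_trans (rnormB _ _) _; rewrite lerD2r ltW.
  have C0 : 0 < 1 + `|C| by rewrite ltr_pwDl.
  (* On a ball of radius at most 1/(1 + |C|) the values of [T] vary by at most 1, so n + 1 at the
     centre leaves at least n. *)
  exists (x', Num.min (r / 2) (1 + `|C|)^-1) => _ /=; split=> //.
  - by rewrite lt_min divr_gt0//= invr_gt0.
  - by rewrite ge_min lexx.
  exists T => // y; rewrite le_min => /andP[_ yx].
  have : rnorm (T y - T x') <= 1.
    rewrite -TB; apply: le_trans (TC _) _.
    apply: le_trans (_ : (1 + `|C|) * rnorm (y - x') <= _).
      rewrite ler_wpM2r ?rnorm_ge0//; apply: le_trans (ler_norm _) _.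
      by rewrite lerDr.
    by rewrite -ler_pdivlMl// mulr1.
  rewrite rnormC => h; have := rnorm_leD (T x') (T y).
  by move: h Tx'; lra.
have /choice[f fP] (np : nat * (V * R)) := step np.1 np.2.
pose p := fix p n := if n is m.+1 then f (m, p m) else (0, 1).
have r0 n : 0 < (p n).2.
  by elim: n => [|n ih] /=; [exact: ltr01|have [] := fP (n, p n) ih].
have pP n := fP (n, p n) (r0 n).
have rle n : (p n).2 <= 1 / 2 ^+ n.
  elim: n => [|n ih]; first by rewrite /= expr0 divr1.
  have [_ h _ _] := pP n; apply: le_trans h _.
  by rewrite exprSr invfM mulrA ler_pM2r ?invr_gt0.
(* Each centre moves by at most the loss of radius, so the limit of the centres lies in every
   ball. *)
have dist n j : rnorm ((p (n + j)%N).1 - (p n).1) <= (p n).2 - (p (n + j)%N).2.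
  elim: j => [|j ih]; first by rewrite addn0 !subrr rnorm0.
  apply: le_trans (rnorm_trans (p (n + j)%N).1 _ _) _.
  by rewrite addnS /=; have [_ h1 h2 _] := pP (n + j)%N; move: ih h1 h2 => /=; lra.
have [x px] : exists l, rcvg (fun n => (p n).1) l.
  apply: rcauchy_rcvg => e e0.
  have [K Ke] : exists K, e^-1 <= 2 ^+ K.
    exists (Num.truncn e^-1).+1; apply: le_trans (ltW (truncnS_gt _)) _.
    by rewrite -natrX ler_nat ltnW// ltn_expl.
  exists K => k /subnKC <-; apply: le_trans (dist _ _) _.
  apply: (@le_trans _ _ (1 / 2 ^+ K)); first by have := rle K; have := r0 (K + (k - K))%N; lra.
  by rewrite div1r invf_ple ?posrE ?exprn_gt0.
(* Step number truncn M + 1 exceeds [M]; the ball it produces has the next index. *)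
have [M xM] := Fpt x; have [T FT /(_ x) Tx] : exists2 T, F T & forall y,
    rnorm (y - (p (Num.truncn M).+2).1) <= (p (Num.truncn M).+2).2 ->
    (Num.truncn M).+1%:R <= rnorm (T y) by have [] := pP (Num.truncn M).+1.
have := xM T FT; apply/negP; rewrite -ltNge.
apply: lt_le_trans (truncnS_gt M) (Tx _).
set n := (Num.truncn M).+2; apply/ler_addgt0Pr => e /px[K xK].
have := rnorm_trans (p (n + K)%N).1 x (p n).1.
have := xK (n + K)%N (leq_addl _ _); rewrite rnormC.
have := dist n K; have := r0 (n + K)%N; lra.
Qed.
End UniformBoundedness.

(** * Isometry, strong continuity and uniqueness of orbits *)

Section GeneratedGroup.
Variables (R : realType) (V : completeNormedModType R[i]).
Variables (D : set V) (delta : V -> V) (S : R -> V -> V).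
Hypothesis G : group_generated D delta S.

(** Both [S t] and its inverse [S (- t)] are contractions. *)
Lemma gg_norm t a : rnorm (S t a) = rnorm a.
Proof.
apply/eqP; rewrite eq_le (ctr_le (gg_ctr G t))/= -{1}(gg_0 G a) -(addNr t).
by rewrite (gg_add G); exact: (ctr_le (gg_ctr G (- t))).
Qed.

Lemma gg_cont : (forall a (e : R), 0 < e -> exists2 x, D x & rnorm (a - x) <= e) ->
  forall a (e : R), 0 < e -> exists2 r : R, 0 < r &
    forall h, `|h| < r -> rnorm (S h a - a) <= e.
Proof.
move=> Dd a e e0; have e30 : 0 < e / 3 by rewrite divr_gt0.
have [x Dx ax] := Dd a _ e30; have n0 : 0 < 1 + rnorm (delta x).
  by rewrite ltr_pwDl// rnorm_ge0.
exists (e / 3 / (1 + rnorm (delta x))); first by rewrite divr_gt0.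
move=> h; rewrite ltr_pdivlMr// => hx.
have := rnorm_trans (S h x) (S h a) a; have := rnorm_trans x (S h x) a.
rewrite (rnormC x a) -(ctrB _ _ (gg_ctr G h)) gg_norm.
have : rnorm (S h x - x) <= e / 3.
  apply: le_trans (gg_lip G h Dx) _; apply: le_trans (ltW hx).
  by rewrite ler_wpM2l// lerDr.
by move: ax; lra.
Qed.

(** The distance from [g s] to [S s (g 0)] has derivative zero: isometry of [S h] lets the two
    orbits be compared after the same time step. It serves below for the involution and for the
    product. *)
Lemma gg_unique (g : R -> V) :
  (forall t e : R, 0 < e -> exists2 r : R, 0 < r &
    forall h, `|h| < r -> rnorm (g (t + h) - S h (g t)) <= `|h| * e) ->
  forall t, g t = S t (g 0).
Proof.
move=> gP t; apply/subr0_eq/rnorm_eq0.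
pose f s := rnorm (g s - S s (g 0)); rewrite -/(f t).
have <- : f 0 = 0 by rewrite /f (gg_0 G) subrr rnorm0.
apply: zero_derivative_cst => {}t e e0; have [r r0 gr] := gP t e e0.
exists r => // h /gr; apply: le_trans.
have -> : f t = rnorm (S h (g t) - S (t + h) (g 0)).
  by rewrite /f (addrC t h) (gg_add G) -(ctrB _ _ (gg_ctr G h)) gg_norm.
apply: le_trans (rnorm_dist _ _) _.
by rewrite opprB addrA subrK.
Qed.
End GeneratedGroup.

(** * Module operations, invariant forms and the weak product *)

Section QuasiStarAlgebra.
Variables (R : realType) (V : completeNormedModType R[i]) (Q : BQSA V).
Local Notation "a '^#'" := (Defs.inv Q a) (at level 2, format "a ^#").
Local Notation "a ** x" := (Defs.mul Q a x) (at level 40).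
Local Notation A0 := (Defs.A0 Q).

Lemma A0_rdense a (e : R) : 0 < e -> exists2 x, A0 x & rnorm (a - x) <= e.
Proof. by apply: (rnorm_closureP _ _).1; rewrite (A0_dense Q). Qed.

Lemma conjRc (t : R) : ((t%:C)%C : R[i])^* = (t%:C)%C.
Proof. by apply/CrealP; apply/complex_realP; exists t. Qed.

Lemma inv_rscale (t : R) a : (t *:r a)^# = t *:r a^#.
Proof. by rewrite inv_scale conjRc. Qed.

Lemma invN a : (- a)^# = - a^#.
Proof. by rewrite -scaleN1r inv_scale rmorphN1 scaleN1r. Qed.

Lemma invB a b : (a - b)^# = a^# - b^#.
Proof. by rewrite inv_add invN. Qed.

Lemma rnorm_inv a : rnorm a^# = rnorm a.
Proof. by rewrite /rnorm norm_inv. Qed.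

Lemma mul0A x : A0 x -> 0 ** x = 0.
Proof. by move=> Ax; rewrite -(scale0r (0 : V)) (mulZ_r 0 0 Ax).1 !scale0r. Qed.

Lemma mulA0 a : a ** 0 = 0.
Proof. by rewrite -(scale0r (0 : V)) (mulZ_r 0 a (A0_0 Q)).2 !scale0r. Qed.

Lemma mulNA a x : A0 x -> (- a) ** x = - (a ** x).
Proof. by move=> Ax; rewrite -scaleN1r (mulZ_r _ _ Ax).1 scaleN1r. Qed.

Lemma mulBA a b x : A0 x -> (a - b) ** x = a ** x - b ** x.
Proof. by move=> Ax; rewrite (mulDl_r _ _ Ax) mulNA. Qed.

Lemma mulAB a x y : A0 x -> A0 y -> a ** (x - y) = a ** x - a ** y.
Proof.
move=> Ax Ay; rewrite -(scaleN1r y) mulDr_r ?(mulZ_r _ _ Ay).2 ?scaleN1r -?(scaleN1r y)//.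
exact: A0_scale.
Qed.

Lemma mul_r_bounded x : A0 x -> exists C : R, forall a, rnorm (a ** x) <= C * rnorm a.
Proof.
move=> Ax; have /(_ 0) := mul_r_cont Ax.
rewrite /continuous_at (mul0A Ax) => /rnorm_cvg/(_ 1 ltr01)/rnorm_nbhs[r r0 xr].
exists (2 / r) => a; have [->|a0] := eqVneq a 0.
  by rewrite mul0A// rnorm0 mulr0.
have m0 : 0 < rnorm a.
  rewrite lt_neqAle rnorm_ge0 andbT eq_sym; apply: contra_neq a0.
  exact: rnorm_eq0.
have := xr ((r / 2 / rnorm a) *:r a); rewrite sub0r rnormN rnormZ subr0.
have h0 : 0 < r / 2 / rnorm a by rewrite !divr_gt0.
rewrite (mulZ_r _ _ Ax).1 rnormZ gtr0_norm// mulfVK ?gt_eqF// => ax1.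
have {ax1} : r / 2 / rnorm a * rnorm (a ** x) <= 1.
  by apply: ax1; rewrite ltr_pdivrMr// ltr_pMr// ltr1n.
by rewrite -ler_pdivlMl// mulr1 invf_div invf_div mulrA [_ * 2]mulrC mulrAC.
Qed.

Lemma mul_l_real_bound a : (exists M : R[i], forall x, A0 x -> `|a ** x| <= M * `|x|) ->
  exists M : R, forall x, A0 x -> rnorm (a ** x) <= M * rnorm x.
Proof.
move=> [M aM]; exists (complex.Re M) => x Ax; have := aM x Ax.
rewrite !rnormE lecE => /andP[_]; case: M {aM} => m n /=.
by rewrite mulr0 subr0.
Qed.

Section Forms.
Variable phi : V -> V -> R[i].
Hypothesis phiS : SA0 Q phi.

Lemma formDl a b c : phi (a + b) c = phi a c + phi b c.
Proof. by have [[h _] _] := phiS; exact: h. Qed.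

Lemma formZl (k : R[i]) a c : phi (k *: a) c = k * phi a c.
Proof. by have [[_ [h _]] _] := phiS; exact: h. Qed.

Lemma formDr a b c : phi a (b + c) = phi a b + phi a c.
Proof. by have [[_ [_ [h _]]] _] := phiS; exact: h. Qed.

Lemma formZr (k : R[i]) a c : phi a (k *: c) = k^* * phi a c.
Proof. by have [[_ [_ [_ h]]] _] := phiS; exact: h. Qed.

Lemma form_adj a x y : A0 x -> A0 y -> phi (a ** x) y = phi x (a^# ** y).
Proof. by have [_ [_ [h _]]] := phiS; exact: h. Qed.

Lemma form_le a b : rnorm (phi a b : R[i]^o) <= rnorm a * rnorm b.
Proof.
have [_ [_ [_ /(_ a b)]]] := phiS.
by rewrite -lecR rmorphM /= -!rnormE.
Qed.

Lemma formNl a c : phi (- a) c = - phi a c.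
Proof. by rewrite -scaleN1r formZl mulN1r. Qed.

Lemma formNr a c : phi a (- c) = - phi a c.
Proof. by rewrite -scaleN1r formZr rmorphN1 mulN1r. Qed.

Lemma formBl a b c : phi (a - b) c = phi a c - phi b c.
Proof. by rewrite formDl formNl. Qed.

Lemma formBr a b c : phi a (b - c) = phi a b - phi a c.
Proof. by rewrite formDr formNr. Qed.

(* Polarisation with [a + b] and [a + 'i b]. *)
Lemma form_herm a b : phi b a = (phi a b)^*.
Proof.
have [_ [pos _]] := phiS.
have real c : complex.Im (phi c c) = 0.
  by have := pos c; rewrite lecE => /andP[/eqP].
have := real (a + ('i)%C *: b); have := real (a + b).
rewrite !(formDl, formDr, formZl, formZr) => {pos}.
have := real a; have := real b.
move: (phi a a) (phi b b) (phi a b) (phi b a) => [aa aa'] [bb bb'] [x x'] [y y'] /=.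
move=> -> -> h1 h2; apply/eqP; rewrite eq_complex /=; apply/andP; split; apply/eqP.
  by move: h2; lra.
by move: h1; lra.
Qed.

Lemma rcvg_form (p q : nat -> V) l m : rcvg p l -> rcvg q m ->
  rcvg (fun k => phi (p k) (q k) : R[i]^o) (phi l m).
Proof.
(* [B] bounds |l|, and also |q k| as soon as [q k] is within 1 of [m]. *)
move=> pl qm e e0; pose B := 1 + rnorm l + rnorm m.
have B0 : 0 < B by rewrite /B -addrA ltr_pwDl// addr_ge0 ?rnorm_ge0.
have [e20 r0] : 0 < e / 2 /\ 0 < e / 2 / B by rewrite !divr_gt0.
have [K pK] := pl _ r0.
have m0 : 0 < Num.min 1 (e / 2 / B) by rewrite lt_min ltr01.
have [K' qK] := qm _ m0.
exists (maxn K K') => k; rewrite geq_max => /andP[/pK {}pK /qK].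
rewrite le_min => /andP[q1 q2].
have -> : phi (p k) (q k) - phi l m = phi (p k - l) (q k) + phi l (q k - m).
  by rewrite formBl formBr addrA subrK.
apply: le_trans (@rnormD _ R[i]^o _ _) _; rewrite [e]splitr.
have eB : e / 2 / B * B = e / 2 by rewrite mulfVK// gt_eqF.
apply: lerD; apply: le_trans (form_le _ _) _; rewrite -eB.
  apply: ler_pM; rewrite ?rnorm_ge0//.
  by have := rnorm_leD (q k) m; have := rnorm_ge0 l; rewrite /B; lra.
rewrite mulrC; apply: ler_pM; rewrite ?rnorm_ge0//.
by have := rnorm_ge0 m; rewrite /B; lra.
Qed.
End Forms.

Lemma rcvg_inv (u : nat -> V) a : rcvg u a -> rcvg (fun k => (u k)^#) a^#.
Proof.
by apply: (@rcvg_map _ _ (Defs.inv Q) 1) => b c; rewrite -invB rnorm_inv mul1r.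
Qed.

Lemma rcvg_mul_r (u : nat -> V) a x : A0 x -> rcvg u a -> rcvg (fun k => u k ** x) (a ** x).
Proof.
move=> Ax; have [C xC] := mul_r_bounded Ax.
by apply: (@rcvg_map _ _ (fun a => a ** x) C) => b c; rewrite -mulBA.
Qed.

(** The forms are jointly continuous, and so are the involution and right multiplication by elements
    of [A0]. *)
Lemma weak_prod_closed (u v w : nat -> V) a b c : rcvg u a -> rcvg v b -> rcvg w c ->
  (forall k, is_weak_prod Q (u k) (v k) (w k)) -> is_weak_prod Q a b c.
Proof.
move=> ua vb wc uvw phi phiS x y Ax Ay.
have := rcvg_form phiS (rcvg_mul_r Ax vb) (rcvg_mul_r Ay (rcvg_inv ua)).
have := rcvg_form phiS (rcvg_mul_r Ax wc) (rcvg_cst y).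
have -> : (fun k => phi (w k ** x) y : R[i]^o) =
    (fun k => phi (v k ** x) ((u k)^# ** y)).
  by apply/funext => k; rewrite (uvw k phi phiS).
by move=> h1 h2; apply: (rcvg_unique h2 h1).
Qed.

Lemma weak_prod_inv a b c : is_weak_prod Q a b c -> is_weak_prod Q b^# a^# c^#.
Proof.
move=> abc phi phiS x y Ax Ay; rewrite inv_invol (form_herm phiS) (abc phi phiS)//.
by rewrite (form_adj phiS)// -(form_herm phiS).
Qed.

Lemma weak_prod_A0 a x : A0 x -> is_weak_prod Q a x (a ** x).
Proof.
move=> Ax phi phiS y z Ay Az; rewrite -(form_adj phiS)//; last exact: A0_mul.
by rewrite mod_assoc_r.
Qed.

(** * Uniqueness and existence of weak products *)

Section Core.
Hypothesis core : A0_core_for_all Q.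

(** The core hypothesis for the element 0: the pair [(0, c - c')] lies in the graph of the weak
    multiplication by 0, which is the closure of a graph whose second components all vanish. *)
Lemma weak_prod_separated c c' :
  (forall phi, SA0 Q phi -> forall x y, A0 x -> A0 y -> phi (c ** x) y = phi (c' ** x) y) ->
  c = c'.
Proof.
move=> cc'; apply/subr0_eq/rnorm_small => e e0.
have : graph_Lhat Q 0 (0, c - c').
  move=> phi phiS x y Ax Ay /=; rewrite mul0A// mulBA// (formBl phiS).
  by rewrite (cc' phi phiS)// subrr -(scale0r 0) (formZl phiS) mul0r.
rewrite -core => /rnorm_closure2P/(_ e e0)[[x z] /= [[/= Ax ->] _]].
by rewrite mul0A// subr0.
Qed.

Lemma weak_prod_unique a b c c' :
  is_weak_prod Q a b c -> is_weak_prod Q a b c' -> c = c'.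
Proof.
move=> h h'; apply: weak_prod_separated => phi phiS x y Ax Ay.
by rewrite -(h phi phiS)// -(h' phi phiS).
Qed.

(** Extension by continuity: for [u k] in [A0] tending to [b] the products [a ** u k] are Cauchy,
    and closedness identifies their limit as the weak product. *)
Lemma weak_prod_ex_l a (C : R) : (forall x, A0 x -> rnorm (a ** x) <= C * rnorm x) ->
  forall b, exists2 c, is_weak_prod Q a b c & rnorm c <= C * rnorm b.
Proof.
move=> aC b; have [u Au ub] := dense_rcvg b A0_rdense.
have C0 : 0 < `|C| + 1 by rewrite ltr_wpDl.
have [c uc] : exists c, rcvg (fun k => a ** u k) c.
  apply: rcauchy_rcvg => e e0.
  have [K uK] := ub (e / (`|C| + 1) / 2) ltac:(by rewrite !divr_gt0).
  exists K => k kK; rewrite -mulAB//; apply: le_trans (aC _ _) _.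
    by rewrite -scaleN1r; apply: A0_add => //; exact: A0_scale.
  apply: le_trans (_ : (`|C| + 1) * rnorm (u k - u K) <= _).
    rewrite ler_wpM2r ?rnorm_ge0//; apply: le_trans (ler_norm _) _.
    by rewrite lerDl.
  rewrite -ler_pdivlMl// mulrC; apply: le_trans (rnorm_trans b _ _) _.
  by rewrite [leRHS]splitr lerD ?uK// rnormC uK.
exists c; first by apply: (weak_prod_closed (rcvg_cst a) ub uc) => k; exact: weak_prod_A0.
apply/ler_addgt0Pr => e e0; have e20 : 0 < e / 2 by rewrite divr_gt0.
have [K cK] := uc _ e20.
have [K' uK] := ub (e / 2 / (`|C| + 1)) ltac:(by rewrite divr_gt0).
pose k := maxn K K'; have {}cK := cK k (leq_maxl _ _); have {}uK := uK k (leq_maxr _ _).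
have h1 := rnorm_leD c (a ** u k); have h2 := aC _ (Au k).
rewrite rnormC in h1.
have : C * rnorm (u k) <= C * rnorm b + e / 2.
  rewrite -lerBlDl -mulrBr; apply: le_trans (ler_norm _) _; rewrite normrM.
  apply: le_trans (_ : (`|C| + 1) * rnorm (u k - b) <= _); last first.
    by rewrite -ler_pdivlMl// mulrC.
  apply: ler_pM => //; first by rewrite lerDl.
  exact: rnorm_dist.
by move: cK h1 h2; lra.
Qed.

Lemma weak_prod_ex_r b (C : R) : (forall x, A0 x -> rnorm (b^# ** x) <= C * rnorm x) ->
  forall a, exists2 c, is_weak_prod Q a b c & rnorm c <= C * rnorm a.
Proof.
move=> bC a; have [c bac cC] := weak_prod_ex_l bC a^#.
exists c^#; first by have := weak_prod_inv bac; rewrite !inv_invol.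
by rewrite rnorm_inv -(rnorm_inv a).
Qed.
End Core.
End QuasiStarAlgebra.

(** * The group generated by a weak *-derivation: involution *)

Section DerivationGroup.
Variables (R : realType) (V : completeNormedModType R[i]) (Q : BQSA V).
Variables (D : set V) (delta : V -> V) (S : R -> V -> V).
Local Notation "a '^#'" := (Defs.inv Q a) (at level 2, format "a ^#").
Local Notation "a ** x" := (Defs.mul Q a x) (at level 40).
Local Notation A0 := (Defs.A0 Q).

Hypothesis der : weak_star_derivation Q D delta.
Hypothesis G : group_generated D delta S.

Lemma der_dom_add a b : D a -> D b -> D (a + b).
Proof. by case: der => [[_ [h _]]] *; exact: h. Qed.

Lemma der_dom_scale (k : R[i]) a : D a -> D (k *: a).
Proof. by case: der => [[_ [_ h]]] *; exact: h. Qed.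

Lemma der_dom_inv a : D a -> D a^#.
Proof. by case: der => _ h *; exact: h. Qed.

Lemma der_add a b : D a -> D b -> delta (a + b) = delta a + delta b.
Proof. by case: der => _ _ [h _] *; exact: h. Qed.

Lemma der_scale (k : R[i]) a : D a -> delta (k *: a) = k *: delta a.
Proof. by case: der => _ _ [_ h] *; exact: h. Qed.

Lemma der_dom_A0 x : A0 x -> D x.
Proof. by case: der => _ _ _ [h _] *; exact: h. Qed.

Lemma der_inv_A0 x : A0 x -> delta x^# = (delta x)^#.
Proof. by case: der => _ _ _ [_ h] *; exact: h. Qed.

Lemma der_dom_dense a (e : R) : 0 < e -> exists2 x, D x & rnorm (a - x) <= e.
Proof. by move=> /(A0_rdense Q a)[x /der_dom_A0 Dx ax]; exists x. Qed.

Local Notation delta' a := ((delta a^#)^#).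

(* [S s (S (-s) u^#)^#] is isometric in [u] and equals [u + s (delta u - delta' u)]
   to first order; convexity of the norm removes the error term. *)
Lemma der_diff_dissipative u (s : R) : D u -> 0 < s ->
  rnorm u <= rnorm (u + s *:r (delta u - delta' u)).
Proof.
move=> Du s0; set eta := delta u - _; have Du' := der_dom_inv Du.
have first_order (e : R) : 0 < e -> exists2 r : R, 0 < r & forall h, 0 < h -> h < r ->
    rnorm u <= rnorm (u + h *:r eta) + h * e.
  move=> e0; have e30 : 0 < e / 3 by rewrite divr_gt0.
  have [r1 r10 ur1] := gg_deriv G Du e30; have [r2 r20 ur2] := gg_deriv G Du' e30.
  have [r3 r30 ur3] := gg_cont G der_dom_dense (delta' u) e30.
  exists (Num.min r1 (Num.min r2 r3)); first by rewrite !lt_min r10 r20.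
  move=> h h0; rewrite !lt_min => /and3P[h1 h2 h3].
  have hn : `|h| = h by rewrite gtr0_norm.
  have {}ur1 := ur1 h ltac:(by rewrite hn).
  have {}ur2 := ur2 (- h) ltac:(by rewrite normrN hn).
  have {}ur3 := ur3 h ltac:(by rewrite hn).
  rewrite hn in ur1; rewrite normrN hn in ur2.
  set E := S (- h) u^# - _ - _ in ur2.
  have cS := gg_ctr G h.
  pose w := S h (S (- h) u^#)^#.
  have SE : S h E^# = w - S h u + h *:r S h (delta' u).
    rewrite /E !invB inv_rscale inv_invol (ctrB _ _ cS) (ctrB _ _ cS) (ctrZ cS).
    by rewrite rmorphN scaleNr opprK.
  (* All terms beyond first order are collected in the bracket, each at most h e / 3 in norm. *)
  have wE : w = u + h *:r eta +
      (S h E^# + ((S h u - u - h *:r delta u) - h *:r (S h (delta' u) - delta' u))).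
    rewrite SE /eta !scalerBr; move: (h *:r delta u) (h *:r S h _) (h *:r delta' u).
    move: (S h u) w {SE} => A w C B H; rewrite [- (B - H)]opprB.
    rewrite [w - A + B + _]addrACA [B + (H - B)]addrC subrK.
    rewrite [w - A + _]addrA [w - A + _]addrA subrK -[_ - C + H]addrA.
    by rewrite [- C + H]addrC -[H - C]opprB -[w - u - _]addrA -opprD [RHS]addrC subrK.
  have -> : rnorm u = rnorm w.
    by rewrite /w (gg_norm G) rnorm_inv (gg_norm G) rnorm_inv.
  rewrite {1}wE; apply: le_trans (rnormD _ _) _; rewrite lerD2l.
  apply: le_trans (rnormD _ _) _; rewrite (gg_norm G) rnorm_inv.
  have := rnormB (S h u - u - h *:r delta u) (h *:r (S h (delta' u) - delta' u)).
  rewrite rnormZ hn; have := ler_wpM2l (ltW h0) ur3; move: ur1 ur2.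
  have -> : h * e = h * (e / 3) + (h * (e / 3) + h * (e / 3)) by field.
  lra.
apply/ler_addgt0Pr => e e0; have es0 : 0 < e / s by rewrite divr_gt0.
have [r r0 ur] := first_order _ es0.
(* [u + q s eta] is the convex combination of [u] and [u + s eta] with weight [q]; [q] is small
   enough for the first-order bound, whose error q s (e / s) = q e scales with [q]. *)
pose q := Num.min 1 (r / s / 2).
have q0 : 0 < q by rewrite lt_min ltr01 !divr_gt0.
have q1 : q <= 1 by rewrite ge_min lexx.
have qr : q * s < r.
  apply: (@le_lt_trans _ _ (r / 2)); last by rewrite ltr_pdivrMr// ltr_pMr// ltr1n.
  by rewrite -ler_pdivlMr// mulrAC ge_min lexx orbT.
have := ur _ (mulr_gt0 q0 s0) qr.
have -> : u + (q * s) *:r eta = (1 - q) *:r u + q *:r (u + s *:r eta).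
  by rewrite rmorphM -scalerA (scalerDr _ u) [RHS]addrA -scalerDl -rmorphD subrK scale1r.
have := rnormD ((1 - q) *:r u) (q *:r (u + s *:r eta)).
rewrite !rnormZ (ger0_norm (ltW q0)) ger0_norm ?subr_ge0//.
have -> : q * s * (e / s) = q * e by field; rewrite gt_eqF.
move=> h1 h2; rewrite -(ler_pM2l q0); move: h1 h2; rewrite mulrBl mul1r mulrDr; lra.
Qed.

(* [delta - delta'] is dissipative, hence closable, and vanishes on the dense set [A0]. *)
Lemma der_inv a : D a -> delta a^# = (delta a)^#.
Proof.
move=> Da; have Da' := der_dom_inv Da.
suff b0 : delta a - delta' a = 0.
  by rewrite -[LHS](inv_invol Q) -(subr0_eq b0).
apply: rnorm_small => e e0; set b := delta a - _.
have e40 : 0 < e / 4 by rewrite divr_gt0.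
have [y Ay by_] := A0_rdense Q (- b) e40.
have n0 : 0 < 1 + rnorm a by rewrite ltr_pwDl// rnorm_ge0.
pose r := e / 4 / (1 + rnorm a); have r0 : 0 < r by rewrite divr_gt0.
have ra : r * rnorm a <= e / 4.
  apply: le_trans (_ : r * (1 + rnorm a) <= _); last by rewrite mulfVK// gt_eqF.
  by rewrite ler_pM2l// lerDr.
have Dra : D (r *:r a) := der_dom_scale _ Da.
have Dy := der_dom_A0 Ay.
(* Dissipativity at y + r a with parameter 1/r gives |y + r a| <= |y + b + r a|, because delta -
   delta' kills [y]. With [y] near [- b] this yields |b| <= 2 |y + b| + 2 r |a|. *)
have := der_diff_dissipative (der_dom_add Dy Dra) (_ : 0 < r^-1).
rewrite inv_add inv_rscale !der_add ?der_scale//; last 2 first.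
- exact/der_dom_inv.
- exact/der_dom_scale.
rewrite der_inv_A0// inv_add inv_invol inv_rscale.
rewrite opprD addrACA subrr add0r -scalerBr -/b scalerA -rmorphM mulVf ?gt_eqF//.
rewrite rmorph1 scale1r invr_gt0 => /(_ r0) h.
have := rnormD (y + b) (r *:r a); rewrite addrAC => h2.
have := rnorm_leD y (- (r *:r a)); rewrite opprK rnormN => h3.
have := rnorm_leD b (- y); rewrite opprK rnormN (addrC b) => h4.
have yb : rnorm (y + b) = rnorm (- b - y) by rewrite -rnormN opprD addrC.
rewrite rnormZ gtr0_norm// in h2 h3; move: h h2 h3 h4 by_ ra; rewrite yb; lra.
Qed.

(** By [der_inv], the orbit conjugated by the involution solves the same evolution equation, so
    [gg_unique] applies on [D]; density extends the equality. *)
Lemma gg_inv t a : S t a^# = (S t a)^#.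
Proof.
pose T a := (S t a^#)^#; suff h : forall b, S t b = T b.
  by rewrite h /T inv_invol.
have cS := gg_ctr G t.
have cT : contraction T.
  split=> [b c|k b|b]; rewrite /T.
  - by rewrite inv_add (ctrD cS) inv_add.
  - by rewrite inv_scale (ctrZ cS) inv_scale conjCK.
  - by rewrite rnorm_inv (gg_norm G) rnorm_inv.
apply: (ctr_eq_dense cS cT der_dom_dense) => {}a Da.
pose g s := (S s a^#)^#; have <- : g 0 = a by rewrite /g (gg_0 G) inv_invol.
rewrite -(gg_unique G (g := g)) => [|s e e0]; first by rewrite /T /g (gg_0 G) inv_invol.
have Db : D (S s a^#) by apply/(gg_dom G)/der_dom_inv.
have e20 : 0 < e / 2 by rewrite divr_gt0.
have [r1 r10 br1] := gg_deriv G Db e20.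
have [r2 r20 br2] := gg_deriv G (der_dom_inv Db) e20.
exists (Num.min r1 r2) => [|h]; first by rewrite lt_min r10.
rewrite lt_min => /andP[/br1 {}br1 /br2]; rewrite der_inv// => {}br2.
rewrite /g (addrC s h) (gg_add G) [e]splitr mulrDr; set b := S s a^# in br1 br2 *.
apply: le_trans (rnorm_trans (b^# + h *:r (delta b)^#) _ _) _; apply: lerD.
  by rewrite -inv_rscale -inv_add -invB rnorm_inv opprD addrA.
by rewrite rnormC opprD addrA.
Qed.

(** * The group and the weak product *)

Section Products.
Hypothesis bounded : forall a, D a -> bounded_elt Q a.
Hypothesis core : A0_core_for_all Q.
Variable J : V -> V.
Hypothesis J_ctr : contraction J.
Hypothesis J_dom : forall c, D (J c).
Hypothesis JK : forall a, D a -> J (a - delta a) = a.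

Lemma der_dom_bound : exists C : R, forall a, D a -> forall x, A0 x ->
  rnorm (a ** x) <= C * rnorm (a - delta a) * rnorm x.
Proof.
(* The family is indexed by the unit ball of [A0]. Each member is bounded because right
   multiplication by [x] is; the family is pointwise bounded because [J c] is a bounded element. *)
pose F : set (V -> V) :=
  [set T | exists x, [/\ A0 x, rnorm x <= 1 & T = fun c => J c ** x]].
have [||C FC] := @uniform_boundedness _ _ F.
- move=> _ [x [Ax x1 ->]]; split=> [a b|k a|].
  + by rewrite (ctrD J_ctr) mulDl_r.
  + by rewrite (ctrZ J_ctr) (mulZ_r _ _ Ax).1.
  have [C xC] := mul_r_bounded Ax; exists `|C| => a.
  apply: le_trans (xC _) _.
  apply: le_trans (_ : `|C| * rnorm (J a) <= _).
    by rewrite ler_wpM2r ?rnorm_ge0// ler_norm.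
  by rewrite ler_wpM2l// (ctr_le J_ctr).
- move=> a; have [/mul_l_real_bound[M aM] _] := bounded (J_dom a).
  exists `|M| => _ [x [Ax x1 ->]]; apply: le_trans (aM x Ax) _.
  apply: le_trans (_ : `|M| * rnorm x <= _).
    by rewrite ler_wpM2r ?rnorm_ge0// ler_norm.
  by rewrite ler_piMr.
exists C => a Da x Ax; have [->|x0] := eqVneq x 0.
  by rewrite mulA0 rnorm0 mulr0.
have m0 : 0 < rnorm x.
  rewrite lt_neqAle rnorm_ge0 andbT eq_sym; apply: contra_neq x0.
  exact: rnorm_eq0.
have nx : rnorm ((rnorm x)^-1 *:r x) <= 1.
  by rewrite rnormZ gtr0_norm ?invr_gt0// mulVf// gt_eqF.
have := FC _ (ex_intro _ _ (And3 (A0_scale _ Ax) nx erefl)) (a - delta a).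
rewrite JK// (mulZ_r _ _ Ax).2 rnormZ gtr0_norm ?invr_gt0//.
by rewrite ler_pdivrMl// mulrC.
Qed.

Lemma der_weak_prod a b c p q : D a -> D b -> is_weak_prod Q a b c ->
  is_weak_prod Q (delta a) b p -> is_weak_prod Q a (delta b) q ->
  D c /\ delta c = p + q.
Proof.
move=> Da Db abc pP qP; have [_ _ _ _ /(_ a b c Da Db abc)[Dc cE]] := der.
split=> //; apply: (weak_prod_separated core) => phi phiS x y Ax Ay.
by rewrite (cE phi phiS)// (pP phi phiS)// (qP phi phiS)// mulDl_r// (formDl phiS).
Qed.

(** Product rule. The remainder is S_h a [] (S_h b - b - h delta b), plus (S_h a - a - h delta a) []
    b, plus h (S_h a - a) [] delta b; these are [w1], [w2] and [h *:r w4]. *)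
Lemma gg_weak_prod_deriv a b c : D a -> D b -> is_weak_prod Q a b c ->
  forall e : R, 0 < e -> exists2 r : R, 0 < r & forall h, `|h| < r ->
  forall c', is_weak_prod Q (S h a) (S h b) c' -> rnorm (c' - S h c) <= `|h| * e.
Proof.
move=> Da Db abc e e0; have [C DC] := der_dom_bound.
pose A := `|C| * rnorm (a - delta a).
have A0' : 0 <= A by rewrite mulr_ge0 ?rnorm_ge0.
(* The bound is uniform in [h], since [a - delta a] moves isometrically along the orbit. *)
have aA h x : A0 x -> rnorm (S h a ** x) <= A * rnorm x.
  move=> Ax; apply: le_trans (DC _ (gg_dom G h Da) _ Ax) _.
  rewrite (gg_gen G h Da) -(ctrB _ _ (gg_ctr G h)) (gg_norm G).
  by rewrite ler_wpM2r ?rnorm_ge0// ler_wpM2r ?rnorm_ge0// ler_norm.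
have aA0 x : A0 x -> rnorm (a ** x) <= A * rnorm x.
  by move=> /(aA 0); rewrite (gg_0 G).
pose B := `|C| * rnorm (b^# - delta b^#).
have B0 : 0 <= B by rewrite mulr_ge0 ?rnorm_ge0.
have bB x : A0 x -> rnorm (b^# ** x) <= B * rnorm x.
  move=> Ax; apply: le_trans (DC _ (der_dom_inv Db) _ Ax) _.
  by rewrite ler_wpM2r ?rnorm_ge0// ler_wpM2r ?rnorm_ge0// ler_norm.
have [p pP _] := weak_prod_ex_r bB (delta a).
have [q qP _] := weak_prod_ex_l aA0 (delta b).
have [Dc dc] := der_weak_prod Da Db abc pP qP.
pose M := 1 + A + B; have M0 : 0 < M by rewrite /M -addrA ltr_pwDl// addr_ge0.
(* The errors add up to |h| e1 (3A + B + 2), at most 6 M |h| e1. *)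
pose e1 := e / (6 * M); have e10 : 0 < e1 by rewrite divr_gt0// mulr_gt0.
(* No bound on multiplication by [delta b] is at hand, so it is approximated by [x] in [A0], for
   which [(S h a - a) ** x] is small with [S h a - a]. *)
have [x Ax bx] := A0_rdense Q (delta b) e10.
have [X xX] := mul_r_bounded Ax.
have X0 : 0 < 1 + `|X| by rewrite ltr_pwDl.
have f0 : 0 < e1 / (1 + `|X|) by rewrite divr_gt0.
have [r1 r10 hr1] := gg_deriv G Da e10; have [r2 r20 hr2] := gg_deriv G Db e10.
have [r3 r30 hr3] := gg_deriv G Dc e10.
have [r4 r40 hr4] := gg_cont G der_dom_dense a f0.
exists (Num.min r1 (Num.min r2 (Num.min r3 r4))); first by rewrite !lt_min r10 r20 r30.
move=> h; rewrite !lt_min => /and4P[/hr1 {}hr1 /hr2 {}hr2 /hr3 {}hr3 /hr4 {}hr4] c' c'P.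
have [w1 w1P w1le] := weak_prod_ex_l (aA h) (S h b - b - h *:r delta b).
have [w2 w2P w2le] := weak_prod_ex_r bB (S h a - a - h *:r delta a).
have aA2 z : A0 z -> rnorm ((S h a - a) ** z) <= (A + A) * rnorm z.
  move=> Az; rewrite mulBA// mulrDl; apply: le_trans (rnormB _ _) _.
  by rewrite lerD ?aA ?aA0.
have [w3 w3P w3le] := weak_prod_ex_l aA2 (delta b - x).
pose w4 := w3 + (S h a - a) ** x.
have w4P := weak_prod_A0 (S h a - a) Ax.
have c'E : c' - c - h *:r delta c = w1 + (w2 + h *:r w4).
  apply: (weak_prod_separated core) => phi phiS y z Ay Az.
  rewrite dc /w4 !(mulDl_r, mulNA, (mulZ_r _ _ Ay).1)//.
  rewrite !(formDl phiS, formNl phiS, formZl phiS).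
  rewrite -(c'P phi phiS)// -(abc phi phiS)// -(pP phi phiS)// -(qP phi phiS)//.
  rewrite -(w1P phi phiS)// -(w2P phi phiS)// -(w3P phi phiS)//.
  have -> : phi ((S h a ** x) ** y) z - phi ((a ** x) ** y) z =
      phi (x ** y) ((S h a - a)^# ** z).
    by rewrite (w4P phi phiS)// !mulBA// (formBl phiS).
  rewrite !(inv_add, invN, inv_rscale).
  rewrite !(mulDl_r, mulNA, (mulZ_r _ _ Ay).1, (mulZ_r _ _ Az).1)//.
  rewrite !(formDl phiS, formNl phiS, formZl phiS, formDr phiS, formNr phiS, formZr phiS).
  rewrite !conjRc; ring.
have w4le : rnorm w4 <= (A + A) * e1 + e1.
  apply: le_trans (rnormD _ _) _; apply: lerD.
    by apply: le_trans w3le _; rewrite ler_wpM2l// addr_ge0.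
  apply: le_trans (xX _) _.
  apply: le_trans (_ : (1 + `|X|) * rnorm (S h a - a) <= _).
    rewrite ler_wpM2r ?rnorm_ge0//; apply: le_trans (ler_norm _) _.
    by rewrite lerDr.
  by rewrite -ler_pdivlMl// mulrC.
have := rnorm_trans (c + h *:r delta c) c' (S h c).
rewrite opprD addrA c'E.
have -> : rnorm (c + h *:r delta c - S h c) = rnorm (S h c - c - h *:r delta c).
  by rewrite -rnormN opprB opprD addrA.
have := rnormD w1 (w2 + h *:r w4); have := rnormD w2 (h *:r w4); rewrite rnormZ.
have := ler_wpM2l (normr_ge0 h) w4le.
have := le_trans w1le (ler_wpM2l A0' hr2).
have := le_trans w2le (ler_wpM2l B0 hr1).
have eE : `|h| * e = `|h| * (6 * M * e1).
  by congr (_ * _); rewrite /e1 mulrC mulfVK// gt_eqF// mulr_gt0.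
have he : 0 <= `|h| * e1 by rewrite mulr_ge0// ltW.
have := mulr_ge0 A0' he; have := mulr_ge0 B0 he.
move: hr3; rewrite eE /M; lra.
Qed.

(** The weak products of [S s a] and [S s b] exist because [S s a] stays in [D]; as a function of
    [s] they satisfy the hypothesis of [gg_unique]. *)
Lemma gg_weak_prod_dom t a b c : D a -> D b -> is_weak_prod Q a b c ->
  is_weak_prod Q (S t a) (S t b) (S t c).
Proof.
move=> Da Db abc.
have /choice[g gP] s : exists c', is_weak_prod Q (S s a) (S s b) c'.
  have [/mul_l_real_bound[M aM] _] := bounded (gg_dom G s Da).
  by have [c' ? _] := weak_prod_ex_l aM (S s b); exists c'.
have g0 : g 0 = c.
  by apply: (weak_prod_unique core (gP 0)); rewrite !(gg_0 G).
rewrite -g0 -(gg_unique G) // => s e e0.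
have [r r0 hr] := gg_weak_prod_deriv (gg_dom G s Da) (gg_dom G s Db) (gP s) e0.
exists r => // h hh; apply: hr => //.
by rewrite -!(gg_add G) (addrC h s); exact: gP.
Qed.

Lemma gg_weak_prod t a b c : is_weak_prod Q a b c ->
  is_weak_prod Q (S t a) (S t b) (S t c).
Proof.
have cvgS u l : rcvg u l -> rcvg (S t \o u) (S t l).
  by apply: rcvg_map (fun a b => ctr_leB a b (gg_ctr G t)).
(* First an arbitrary left factor with a right factor in [A0], by approximating the left factor from
   [A0]. *)
have aux d x : A0 x -> is_weak_prod Q (S t d) (S t x) (S t (d ** x)).
  move=> Ax; have [u Au ud] := dense_rcvg d (A0_rdense Q).
  apply: (weak_prod_closed (cvgS _ _ ud) (rcvg_cst _) (cvgS _ _ (rcvg_mul_r Ax ud))).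
  move=> k; apply: gg_weak_prod_dom; [exact: der_dom_A0 | exact: der_dom_A0 |].
  exact: weak_prod_A0.
move=> abc; have : graph_Lhat Q a (b, c) by [].
(* The core hypothesis supplies [u k] in [A0] with [u k] tending to [b] and [a ** u k] to [c]
   simultaneously. *)
rewrite -core => /rnorm_closure2P cl.
have /choice[u uP] k : exists x, [/\ A0 x, rnorm (b - x) <= k.+1%:R^-1 &
    rnorm (c - a ** x) <= k.+1%:R^-1 :> R].
  have [[x z] /= [[/= Ax ->] bx cx]] := cl k.+1%:R^-1 ltac:(by rewrite invr_gt0).
  by exists x.
have ub : rcvg u b by apply: rcvg_harmonic => k; have [] := uP k.
have uc : rcvg (fun k => a ** u k) c by apply: rcvg_harmonic => k; have [] := uP k.
apply: (weak_prod_closed (rcvg_cst _) (cvgS _ _ ub) (cvgS _ _ uc)) => k.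
by apply: aux; have [] := uP k.
Qed.
End Products.
End DerivationGroup.

(** * Assembly of the group from the resolvent hypotheses *)

Theorem theorem5p3 (R : realType) (V : completeNormedModType R[i])
  (Q : BQSA V) (D : set V) (delta : V -> V) :
  star_semisimple Q ->
  weak_star_derivation Q D delta ->
  (forall a, D a -> bounded_elt Q a) ->
  closed_op D delta ->
  (forall lambda : R, lambda != 0 -> in_resolvent D delta (lambda%:C)%C) ->
  (forall (lambda : R) a, D a ->
     `|(lambda%:C)%C| * `|a| <= `|delta a - (lambda%:C)%C *: a|) ->
  A0_core_for_all Q ->
  exists beta : R -> V -> V,
    [/\ one_param_group Q beta, uniformly_bounded_group beta,
        norm_continuous_group beta & is_generator beta D delta].
Proof.
move=> _ der bounded _ res diss core.
have hK (h : R) (a : V) : h != 0 -> h *:r (h^-1 *:r a) = a.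
  by move=> h0; rewrite scalerA -rmorphM mulfV// scale1r.
(* The spectral parameter is lambda = 1/h, here and in the dissipativity estimate. *)
have range_D (h : R) : h != 0 -> forall c, exists2 a, D a & a - h *:r delta a = c.
  move=> h0 c; have hV0 : h^-1 != 0 by rewrite invr_eq0.
  have [_ [/(_ (h^-1 *:r c))[a Da ac] _]] := res _ hV0.
  by exists a; rewrite // -{1}(hK h a h0) -scalerBr ac hK.
have dissip (h : R) a : D a -> rnorm a <= rnorm (a - h *:r delta a).
  move=> Da; have [->|h0] := eqVneq h 0; first by rewrite scale0r subr0.
  have := diss h^-1 a Da; rewrite normcR !rnormE -rmorphM lecR normfV.
  rewrite -ler_pdivlMl ?invr_gt0 ?normr_gt0// invrK -rnormZ scalerBr hK//.
  by rewrite rnormC.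
have [DD DZ] := (der_dom_add der, der_dom_scale der).
have [dD dZ] := (der_add der, der_scale der).
have dense := der_dom_dense der.
have [S G] := hille_yosida DD DZ dD dZ dense range_D dissip.
have one0 : (1 : R) != 0 := oner_neq0 _.
have J_ctr := resolvent_ctr DD DZ dD dZ range_D dissip 1.
have JK a : D a -> resolvent D delta 1 (a - delta a) = a.
  move=> Da; have := resolventK DD DZ dD dZ range_D dissip 1 Da.
  by rewrite scale1r.
have mulS := gg_weak_prod der G bounded core J_ctr
  (fun c => resolvent_dom range_D c one0) JK.
have SK t : cancel (S t) (S (- t)).
  by move=> a; rewrite -(gg_add G) addNr (gg_0 G).
have SKV t : cancel (S (- t)) (S t).
  by move=> a; rewrite -(gg_add G) addrN (gg_0 G).
(* Translation between the division-free derivative and the limit of difference quotients; at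
   [h = 0] the former is trivial. *)
have diff_quot a (l : V) :
    (forall e : R, 0 < e -> exists2 r : R, 0 < r &
      forall h, `|h| < r -> rnorm (S h a - a - h *:r l) <= `|h| * e) <->
    (fun t : R => t^-1 *:r (S t a - a)) @ 0^' --> l.
  have quotE (t e : R) : t != 0 ->
      (rnorm (t^-1 *:r (S t a - a) - l) <= e) = (rnorm (S t a - a - t *:r l) <= `|t| * e).
    move=> t0; rewrite -[in RHS](hK t (S t a - a) t0) -scalerBr rnormZ.
    by rewrite ler_pM2l ?normr_gt0.
  split=> [al|/rnorm_cvg al e e0].
    apply/rnorm_cvg => e /al[r r0 hr]; apply/nbhs_ballP; exists r => //= t.
    by rewrite /ball /= sub0r normrN => tr t0; rewrite quotE// hr.
  have /nbhs_ballP[r r0 hr] := al e e0; exists r => // h hh.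
  have [->|h0] := eqVneq h 0.
    by rewrite (gg_0 G) scale0r subrr subr0 rnorm0 normr0 mul0r.
  by rewrite -quotE//; apply: hr => //; rewrite /ball /= sub0r normrN.
exists S; split.
- split; last by split; [exact: gg_0 G | exact: gg_add G].
  move=> t; split.
  + by split=> *; rewrite ?(ctrD (gg_ctr G t)) ?(ctrZ (gg_ctr G t)).
  + by exists (S (- t)).
  + by move=> a; exact: gg_inv der G t a.
  + move=> a b; split=> [[c abc]|[c abc]]; first by exists (S t c); exact: mulS.
    (* The converse is multiplicativity of the inverse [S (- t)]. *)
    by exists (S (- t) c); rewrite -(SK t a) -(SK t b); exact: mulS.
  + by move=> a b c; exact: mulS.
- by exists 1 => t a; rewrite mul1r !rnormE (gg_norm G).
- move=> a t; apply/rnorm_cvg => e e0; have [r r0 hr] := gg_cont G dense a e0.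
  apply/nbhs_ballP; exists r => //= s; rewrite /ball /= distrC => /hr.
  have -> : S s a = S t (S (s - t) a) by rewrite -(gg_add G) (addrC t) subrK.
  by rewrite -(ctrB _ _ (gg_ctr G t)) (gg_norm G).
- move=> a.
  have gen Da := (diff_quot a (delta a)).1 (gg_deriv G Da).
  split; last exact: gen.
  by split=> [/gen|[l /(diff_quot a l).2 /(gg_max G)//]]; exists (delta a).
Qed.
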